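(* Let $X$ be a right Markov process with state space a Lusin topological space $E$ (with Borel $\sigma$-algebra $\mathcal{B}$) and resolvent $\mathcal{U}=(U_\alpha)_{\alpha>0}$, let $m$ be a $\sigma$-finite $\mathcal{U}$-excessive measure on $E$, and let $\widehat{X}$, with laws $\widehat{\mathbb{P}}^x$, be the dual right process on the larger space $\overline{E}\supset E$ described in the context. Let $u\in L^p(E,m)$, $1\le p<\infty$. Then the following assertions are equivalent. i) The process $(u(X_t))_{t\ge 0}$ is a martingale with respect to $\mathbb{P}^x$ for $m$-a.e. $x\in E$. ii) The process $(u(\widehat{X}_t))_{t\ge 0}$ is a martingale with respect to $\widehat{\mathbb{P}}^x$ for $m$-a.e. $x\in E$. iii) The function $u$ is $\mathsf{L}_p$-harmonic, i.e. $u\in D(\mathsf{L}_p)$ and $\mathsf{L}_p u=0$. iv) The function $u$ is $\widehat{\mathsf{L}}_p$-harmonic, i.e. $u\in D(\widehat{\mathsf{L}}_p)$ and $\widehat{\mathsf{L}}_p u=0$.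
   Context: The process $X$ has laws $\mathbb{P}^x$, lifetime $\zeta$, transition function $P_tf(x)=\mathbb{E}^x(f(X_t);t<\zeta)$ and resolvent $U_\alpha=\int_0^\infty e^{-\alpha t}P_t\,dt$. Functions are extended by $0$ to the cemetery point. The measure $m$ is $\mathcal{U}$-excessive (sub-invariant): $m(\alpha U_\alpha f)\le m(f)$ for all $\alpha>0$ and all $\mathcal{B}$-measurable $f\ge 0$. Then there is a sub-Markovian resolvent of kernels $\widehat{\mathcal{U}}=(\widehat{U}_\alpha)_{\alpha>0}$ on $E$ in weak duality with $\mathcal{U}$ with respect to $m$: $\int_E fU_\alpha g\,dm=\int_E g\widehat{U}_\alpha f\,dm$ for all $\mathcal{B}$-measurable $f,g\ge0$ and $\alpha>0$. Dual process. The following is known and is the setting: there exist a larger Lusin measurable space $(\overline{E},\overline{\mathcal{B}})$ with $E\subset\overline{E}$, $E\in\overline{\mathcal{B}}$, $\mathcal{B}=\overline{\mathcal{B}}|_E$, and two processes $\overline{X}$ and $\widehat{X}$ with common state space $\overline{E}$, such that $\overline{X}$ is a right process on $\overline{E}$ endowed with a Lusin topology having $\overline{\mathcal{B}}$ as Borel $\sigma$-algebra, $\widehat{X}$ is a right process with respect to a second Lusin topology on $\overline{E}$, also generating $\overline{\mathcal{B}}$, the restriction of $\overline{X}$ to $E$ is $X$, and the resolvents of $\overline{X}$ and $\widehat{X}$ are in (weak) duality with respect to $\overline{m}$, where $\overline{m}(A)=m(A\cap E)$ for $A\in\overline{\mathcal{B}}$. In addition, for $\alpha>0$ the $\alpha$-excessive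 functions of $\widehat{X}$ on $\overline{E}$ are precisely the unique extensions by continuity, in the fine topology generated by $\widehat{X}$, of the $\widehat{\mathcal{U}}_\alpha$-excessive functions (those excessive for $(\widehat{U}_{\alpha+\beta})_{\beta>0}$); in particular $E$ is dense in $\overline{E}$ in the fine topology of $\widehat{X}$. $L^p(E,m)$ is identified with $L^p(\overline{E},\overline{m})$, and $u$ is regarded as a function on $\overline{E}$ accordingly (its values on the $\overline{m}$-null set $\overline{E}\setminus E$ being immaterial). Generators. $\mathcal{U}$ and $\widehat{\mathcal{U}}$ extend to strongly continuous resolvents of sub-Markovian contractions on $L^p(E,m)$, $1\le p<\infty$, and these coincide with the resolvents induced by $\overline{X}$ and $\widehat{X}$ respectively. The generator $(\mathsf{L}_p,D(\mathsf{L}_p))$ is defined by $D(\mathsf{L}_p)=\{U_\alpha f: f\in L^p(E,m)\}$ and $\mathsf{L}_p(U_\alpha f)=\alpha U_\alpha f-f$ (independent of $\alpha>0$); $(\widehat{\mathsf{L}}_p,D(\widehat{\mathsf{L}}_p))$ is defined in the same way from $\widehat{\mathcal{U}}$. *)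

(* Defs.v *)
From HB Require Import structures.
From mathcomp Require Import all_boot all_order all_algebra.
From mathcomp Require Import all_classical all_reals all_analysis.
From mathcomp Require Import measurable_realfun.
Import Order.TTheory GRing.Theory Num.Theory numFieldNormedType.Exports.

Set Implicit Arguments.
Unset Strict Implicit.
Unset Printing Implicit Defensive.

Local Open Scope classical_set_scope.
Local Open Scope ring_scope.

(* One measurable space may carry several topologies (two Lusin topologies
   and a fine topology), so a topology is given as its set of open sets. *)
Definition is_topology (T : Type) (O : set (set T)) : Prop :=
  [/\ O setT,
      (forall A B, O A -> O B -> O (A `&` B)) &
      (forall G : set (set T), G `<=` O -> O (\bigcup_(A in G) A))].

(* O makes E homeomorphic to a Borel subset of a compact metric space, and the
   Borel sigma-algebra of O is the given sigma-algebra of E. *)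
Definition lusin_topology (R : realType) (d : measure_display)
    (E : measurableType d) (O : set (set E)) : Prop :=
  (@measurable d E = <<s O>>) /\
  exists (K : metricType R) (j : E -> K),
    [/\ compact [set: K], injective j,
        <<s [set V : set K | open V]>> (range j) &
        O = [set j @^-1` V | V in [set V : set K | open V]]].

Definition universally_measurable (R : realType) (d : measure_display)
    (E : measurableType d) (A : set E) : Prop :=
  forall mu : probability E R, exists B C : set E,
    [/\ measurable B, measurable C, B `<=` A, A `<=` C & mu (C `\` B) = 0%E].

(* The state space is [option E], [None] being the cemetery; only times t >= 0
   matter.  The sigma-algebra of Om is the one on which the laws are defined. *)
Record process (R : realType) (d d' : measure_display)
    (E : measurableType d) (Om : measurableType d') := Process {
  state : R -> Om -> option E ;
  time_shift : R -> Om -> Om ;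
  filt : R -> set (set Om) ;
  law : E -> probability Om R }.

Section process_defs.
Context {R : realType} {d d' : measure_display}.
Context {E : measurableType d} {Om : measurableType d'}.
Implicit Type Z : process R E Om.

(* The event {Z_t \in B}, for B a subset of E. *)
Definition visits Z (t : R) (B : set E) : set Om :=
  state Z t @^-1` (Some @` B).

(* The process t |-> f(Z_t), f being extended by 0 to the cemetery. *)
Definition along (V : nmodType) Z (f : E -> V) (t : R) (w : Om) : V :=
  oapp f 0 (state Z t w).

Definition lifetime Z (w : Om) : \bar R :=
  ereal_inf [set t%:E | t in [set t : R | 0 <= t /\ state Z t w = None]].

Definition transition Z (t : R) (f : E -> \bar R) (x : E) : \bar R :=
  (\int[law Z x]_(w in [set w | t%:E < lifetime Z w]) along Z f t w)%E.

Definition resolvent Z (alpha : R) (f : E -> \bar R) (x : E) : \bar R :=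
  (\int[lebesgue_measure]_(t in `[0%R, +oo[)
     ((expR (- (alpha * t)))%:E * transition Z t f x))%E.

(* P^mu, as a set function on the events of Om. *)
Definition law_from Z (mu : probability E R) (A : set Om) : \bar R :=
  (\int[mu]_x law Z x A)%E.

(* Intersection over all probabilities mu on E of the completions of the
   sigma-algebra at time t by the P^mu-null sets. *)
Definition augmented_filt Z (t : R) : set (set Om) :=
  [set A | forall mu : probability E R, exists B N : set Om,
     [/\ filt Z t B, measurable N, law_from Z mu N = 0%E &
         (A `\` B) `|` (B `\` A) `<=` N]].

End process_defs.

(* Sub-Markovian resolvents enter through their action on [0,+oo]-valued
   measurable functions. *)
Notation operators R E := (R -> (E -> \bar R) -> E -> \bar R).

Definition kernel_op (R : realType) (d : measure_display)
    (E : measurableType d) (U : R -> R.-ker E ~> E) : operators R E :=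
  fun alpha f x => (\int[U alpha x]_y f y)%E.

(* The resolvent equation is written without subtraction: for a <= b,
   U_a = U_b + (b - a) U_a U_b = U_b + (b - a) U_b U_a. *)
Record submarkovian_resolvent (R : realType) (d : measure_display)
    (E : measurableType d) (U : R -> R.-ker E ~> E) : Prop := {
  resolvent_submarkov : forall (alpha : R) (x : E), 0 < alpha ->
    (alpha%:E * U alpha x setT <= 1)%E ;
  resolvent_eq : forall (a b : R) (f : E -> \bar R) (x : E), 0 < a -> a <= b ->
    measurable_fun setT f -> (forall y, 0 <= f y)%E ->
    (kernel_op U a f x = kernel_op U b f x
       + (b - a)%R%:E * kernel_op U a (kernel_op U b f) x)%E /\
    (kernel_op U a f x = kernel_op U b f x
       + (b - a)%R%:E * kernel_op U b (kernel_op U a f) x)%E }.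

Section resolvent_defs.
Context {R : realType} {d : measure_display} {E : measurableType d}.
Implicit Type V : operators R E.

(* f is excessive for the resolvent (V_(alpha + beta))_(beta > 0). *)
Definition excessive V (alpha : R) (f : E -> \bar R) : Prop :=
  [/\ measurable_fun setT f, (forall x, 0 <= f x)%E,
      (forall (beta : R) (x : E), 0 < beta ->
         (beta%:E * V (alpha + beta)%R f x <= f x)%E) &
      (forall x, (beta%:E * V (alpha + beta)%R f x)%E @[beta --> +oo] --> f x)].

Definition excessive_measure V (m : {measure set E -> \bar R}) : Prop :=
  forall (alpha : R) (f : E -> \bar R), 0 < alpha ->
    measurable_fun setT f -> (forall x, 0 <= f x)%E ->
    (\int[m]_x (alpha%:E * V alpha f x) <= \int[m]_x f x)%E.

Definition weak_duality (m : {measure set E -> \bar R}) V (W : operators R E)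
    : Prop :=
  forall (alpha : R) (f g : E -> \bar R), 0 < alpha ->
    measurable_fun setT f -> (forall x, 0 <= f x)%E ->
    measurable_fun setT g -> (forall x, 0 <= g x)%E ->
    (\int[m]_x (f x * V alpha g x) = \int[m]_x (g x * W alpha f x))%E.

(* Coarsest topology making all beta-excessive functions, beta > 0,
   continuous. *)
Definition fine_topology V : set (set E) :=
  smallest (@is_topology E)
    [set A | exists (beta : R) (f : E -> \bar R) (W : set (\bar R)),
       [/\ 0 < beta, excessive V beta f, open W & A = f @^-1` W]].

Definition fine_continuous V (h : E -> \bar R) : Prop :=
  forall W : set (\bar R), open W -> fine_topology V (h @^-1` W).

(* V_alpha acting on a real function of L^p; for f in L^p both terms are
   finite m-almost everywhere. *)
Definition Lp_op V (alpha : R) (f : E -> R) (x : E) : \bar R :=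
  (V alpha ((EFin \o f)^\+) x - V alpha ((EFin \o f)^\-) x)%E.

(* Graph, up to m-a.e. equality, of the generator on L^p(E, m):
   L_p (V_alpha f) = alpha V_alpha f - f, for f in L^p. *)
Definition Lp_generator (m : {measure set E -> \bar R}) (p : R) V
    (u v : E -> R) : Prop :=
  exists (alpha : R) (f : E -> R),
    [/\ 0 < alpha, f \in Lfun m p%:E,
        {ae m, forall x, (u x)%:E = Lp_op V alpha f x} &
        {ae m, forall x, v x = alpha * u x - f x}].

Definition Lp_harmonic (m : {measure set E -> \bar R}) (p : R) V
    (u : E -> R) : Prop :=
  exists2 v : E -> R, Lp_generator m p V u v & {ae m, forall x, v x = 0}.

End resolvent_defs.

Section right_process_defs.
Context {R : realType} {d d' : measure_display}.
Context {E : measurableType d} {Om : measurableType d'}.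

Record markov_process (Z : process R E Om) : Prop := {
  filt_sigma_algebra : forall t : R, 0 <= t ->
    sigma_algebra setT (filt Z t) /\ filt Z t `<=` measurable ;
  filt_le : forall s t : R, 0 <= s -> s <= t -> filt Z s `<=` filt Z t ;
  path_adapted : forall (t : R) (B : set E), 0 <= t -> measurable B ->
    filt Z t (visits Z t B) ;
  path_absorbed : forall (s t : R) (w : Om), 0 <= s -> s <= t ->
    state Z s w = None -> state Z t w = None ;
  path_shift : forall (s t : R) (w : Om), 0 <= s -> 0 <= t ->
    state Z s (time_shift Z t w) = state Z (s + t) w ;
  law_universally_measurable : forall (A : set Om) (S : set (\bar R)),
    measurable A -> measurable S ->
    universally_measurable R [set x | S (law Z x A)] ;
  law_borel : forall (t : R) (B : set E), 0 <= t -> measurable B ->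
    measurable_fun setT (fun x => law Z x (visits Z t B)) ;
  law_normal : forall x, {ae law Z x, forall w, state Z 0 w = Some x} ;
  markov_property : forall (x : E) (s t : R) (A : set Om) (B : set E),
    0 <= s -> 0 <= t -> filt Z s A -> measurable B ->
    law Z x (A `&` visits Z (s + t) B) =
    (\int[law Z x]_(w in A) along Z (fun y => law Z y (visits Z t B)) s w)%E }.

(* Paths are right continuous for O with the cemetery isolated. *)
Record right_process (O : set (set E)) (Z : process R E Om) : Prop := {
  right_markov : markov_process Z ;
  filt_right_continuous : forall t : R, 0 <= t ->
    filt Z t = \bigcap_(s in [set s | t < s]) filt Z s ;
  filt_augmented : forall t : R, 0 <= t -> filt Z t = augmented_filt Z t ;
  excessive_right_continuous : forall (alpha : R) (f : E -> \bar R) x,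
    0 < alpha -> excessive (resolvent Z) alpha f ->
    {ae law Z x, forall w, forall t : R, 0 <= t ->
       along Z f s w @[s --> t^'+] --> along Z f t w} ;
  path_right_continuous : forall x,
    {ae law Z x, forall w, forall (t : R) (y : E), 0 <= t ->
       state Z t w = Some y ->
       forall V : set E, O V -> V y ->
       \forall s \near t^'+, visits Z s V w} }.

(* The martingale property E[Y_t | F_s] = Y_s is the characteristic property
   of the conditional expectation. *)
Record martingale (P : probability Om R) (F : R -> set (set Om))
    (Y : R -> Om -> R) : Prop := {
  martingale_adapted : forall (t : R) (S : set R), 0 <= t -> measurable S ->
    F t (Y t @^-1` S) ;
  martingale_integrable : forall t : R, 0 <= t ->
    P.-integrable setT (EFin \o Y t) ;
  martingale_condexp : forall (s t : R) (A : set Om), 0 <= s -> s <= t ->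
    F s A ->
    (\int[P]_(w in A) (Y t w)%:E = \int[P]_(w in A) (Y s w)%:E)%E }.

End right_process_defs.

Section enlargement.
Context {R : realType} {d d1 d2 d3 : measure_display}.
Context {E : measurableType d} {Eb : measurableType d1}.
Variable i : E -> Eb.

(* Through i, E is a measurable subset of Eb, with the trace sigma-algebra. *)
Definition measurable_subspace : Prop :=
  [/\ injective i, measurable (range i) &
      forall A : set E, measurable A <->
        exists2 B : set Eb, measurable B & A = i @^-1` B].

(* Started in E, Zb stays in E up to its lifetime, and there it has the
   finite-dimensional distributions of Z. *)
Definition restricts_to {Om : measurableType d2} {Omb : measurableType d3}
    (Zb : process R Eb Omb) (Z : process R E Om) : Prop :=
  (forall x, {ae law Zb (i x), forall w, forall t : R, 0 <= t ->
     state Zb t w = None \/ visits Zb t (range i) w}) /\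
  (forall x n (t : 'I_n -> R) (B : 'I_n -> set Eb),
     (forall k, 0 <= t k) -> (forall k, measurable (B k)) ->
     law Zb (i x) (\bigcap_k visits Zb (t k) (B k)) =
     law Z x (\bigcap_k visits Z (t k) (i @^-1` B k))).

(* For every alpha > 0, the alpha-excessive functions of W on Eb are the unique
   extensions, continuous in the fine topology of W, of the alpha-excessive
   functions of V on E. *)
Definition excessive_extensions (V : operators R E) (W : operators R Eb)
    : Prop :=
  forall alpha : R, 0 < alpha ->
    (forall g, excessive V alpha g ->
       exists! h : Eb -> \bar R, fine_continuous W h /\ h \o i = g) /\
    (forall h, excessive W alpha h <->
       fine_continuous W h /\ excessive V alpha (h \o i)).

Definition fine_dense (W : operators R Eb) : Prop :=
  forall A : set Eb, fine_topology W A -> A !=set0 -> A `&` range i !=set0.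

End enlargement.

(* For m-a.e. x, t |-> u(Z_t) is a martingale under the law of Z started at
   i x.  As u stands for a class modulo m-null sets, the process is formed with
   a measurable representative v of u on the state space of Z.  Asking this of
   every representative would be too strong: for the uniform motion on the
   circle, changing u = 1 at a single point destroys the martingale property
   under every law. *)
Definition ae_martingale (R : realType) (d d1 d2 : measure_display)
    (E : measurableType d) (Eb : measurableType d1) (Om : measurableType d2)
    (m : {measure set E -> \bar R}) (i : E -> Eb) (Z : process R Eb Om)
    (u : E -> R) : Prop :=
  exists v : Eb -> R,
    [/\ measurable_fun setT v, {ae m, forall x, v (i x) = u x} &
        {ae m, forall x, martingale (law Z (i x)) (filt Z) (along Z v)}].

(* Main.v *)
Require Import Defs.
From HB Require Import structures.
From mathcomp Require Import all_boot all_order all_algebra.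
From mathcomp Require Import all_classical all_reals all_analysis.
From mathcomp Require Import measurable_realfun ring lra.
Import Order.TTheory GRing.Theory Num.Theory numFieldNormedType.Exports.
Local Open Scope classical_set_scope.
Local Open Scope ring_scope.

(* Let T = a U_a, a sub-Markovian kernel decreasing m.  If T u = u a.e., then
   T (u - c)^+ >= (u - c)^+ for c > 0 (the mass lost by T only helps), and
   sub-invariance of m forces equality a.e.; the same holds for -u.  Varying c,
   one gets for a.e. x that T x charges only the level set {u = u x}, with full
   mass when u x <> 0: u is stationary.  Invariance of a set of finite measure
   passes to a kernel in duality with T (test the duality with indicators), and
   the sets {|u| > c} have finite measure since u is in L^p, so stationarity
   passes to the dual resolvent as well.
   A stationary u gives constant processes: for phi bounded and nonnegative
   with phi 0 = 0, h = T (phi o u) is a-excessive, hence right continuous along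
   the paths, and h(X_t) = phi(u x) for almost every t, hence for every t.
   Conversely a martingale started from x has constant mean, so T u = u after
   integration against an exponential time. *)

(** * Functions fixed by a sub-Markovian kernel *)

(** The kernel [a U_a] is preferred to the semigroup because duality and the generator are both
    expressed by the resolvent. The truncation at [c > 0] is forced twice. First, [m] may be
    infinite and [u] not integrable, while [(|u| - c)^+] is integrable for every [p]. Second, lost
    mass enters as [c (1 - r)], with [r] the total mass of [T x], and this has the right sign only
    for [c >= 0]. Duality is an identity between integrals and says nothing about a single [x], but
    it does carry invariance of a set; this is why stationarity is cut into level sets and
    reassembled on the other side. Stationarity at a single rate already yields constant paths, so
    the rate never has to be varied. Two obstacles remain. One-time laws are assumed measurable in
    the starting point only, so right continuity of the paths has to supply joint measurability with
    time before [a U_a] becomes a kernel. And [u] is a class modulo null sets, so the martingale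
    needs a representative, which is rebuilt from excessive functions. *)

Section ae_lemmas.
Context {R : realType} {d : measure_display} {E : measurableType d}.
Implicit Type m : {measure set E -> \bar R}.

Lemma ge0_integrable m (f : E -> \bar R) :
  measurable_fun setT f -> (forall x, 0 <= f x)%E ->
  (\int[m]_x f x < +oo)%E -> m.-integrable setT f.
Proof.
move=> mf f0 foo; apply/integrableP; split => //.
by under eq_integral do rewrite gee0_abs//.
Qed.

(** The integral of [g - f] is at most zero while [g - f] is nonnegative almost everywhere, so it
    vanishes; finiteness of the integral of [f] makes the subtraction legitimate. This is how
    sub-invariance becomes equality. *)
Lemma ae_le_integral_eq m (f g : E -> \bar R) :
  measurable_fun setT f -> measurable_fun setT g ->
  (forall x, 0 <= f x)%E -> (forall x, 0 <= g x)%E ->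
  {ae m, forall x, (f x <= g x)%E} ->
  (\int[m]_x g x <= \int[m]_x f x)%E -> (\int[m]_x f x < +oo)%E ->
  {ae m, forall x, g x = f x}.
Proof.
move=> mf mg f0 g0 fg gf fi.
have If : m.-integrable setT f by exact: ge0_integrable.
have Ig : m.-integrable setT g.
  by apply: ge0_integrable => //; exact: le_lt_trans gf fi.
have mB : measurable_fun setT (g \- f)%E by exact: emeasurable_funB.
have fin : (\int[m]_x f x)%E \is a fin_num.
  by rewrite ge0_fin_numE// integral_ge0.
have ffin := integrable_ae measurableT If.
have I0 : (\int[m]_x `| (g \- f) x | = 0)%E.
  have -> : (\int[m]_x `| (g \- f) x | = \int[m]_x (g \- f) x)%E.
    apply: ae_eq_integral => //; first exact: measurableT_comp.
    apply: filterS2 fg ffin => x xfg /(_ I) xf _.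
    by rewrite gee0_abs// sube_ge0 ?xf.
  rewrite integralB//; apply/eqP; rewrite eq_le; apply/andP; split.
    by rewrite sube_le0.
  rewrite sube_ge0 ?fin ?orbT//.
  by apply: ae_ge0_le_integral => //; apply: filterS fg.
have := (ae_eq_integral_abs m measurableT mB).1 I0.
apply: filterS2 ffin => x /(_ I) fx /(_ I) /= gfx.
by rewrite -(subeK (g x) fx) gfx add0e.
Qed.

Lemma ae_rat m (P : rat -> E -> Prop) :
  (forall q, {ae m, forall x, P q x}) -> {ae m, forall x, forall q, P q x}.
Proof.
move=> H.
have : {ae m, forall x, forall n : nat, P (odflt 0 (unpickle n)) x}.
  by apply: ae_foralln => n; exact: H.
by apply: filterS => x + q => /(_ (pickle q)); rewrite pickleK.
Qed.

End ae_lemmas.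

(** Zero must be avoided because invariance is available only at levels [c > 0] of [u] and of
    [- u]. *)
Lemma rat_between_neq0 {R : realType} (a b : R) : a < b ->
  exists q : rat, [/\ q != 0, a < ratr q & ratr q < b].
Proof.
move=> ab; have [b0|b0] := ltP 0 b.
  have /rat_in_itvoo[q] : Num.max 0 a < b by rewrite gt_max b0.
  rewrite in_itv/= gt_max => /andP[/andP[q0 aq] qb]; exists q; split => //.
  by move: q0; rewrite ltr0q => /gt_eqF ->.
have /rat_in_itvoo[q] := ab; rewrite in_itv/= => /andP[aq qb].
exists q; split => //; have := lt_le_trans qb b0.
by rewrite ltrq0 => /lt_eqF ->.
Qed.

Section sub_markov.
Context {R : realType} {d : measure_display} {E : measurableType d}.
Implicit Types (m : {measure set E -> \bar R}).
Implicit Types (T S : E -> {measure set E -> \bar R}) (u : E -> R).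

Definition submarkov_kernel T : Prop :=
  (forall A, measurable A -> measurable_fun setT (T ^~ A)) /\
  (forall x, T x setT <= 1)%E.

Definition subinvariant m T : Prop := forall f : E -> \bar R,
  measurable_fun setT f -> (forall x, 0 <= f x)%E ->
  (\int[m]_x \int[T x]_y f y <= \int[m]_x f x)%E.

Definition in_duality m T S : Prop := forall f g : E -> \bar R,
  measurable_fun setT f -> (forall x, 0 <= f x)%E ->
  measurable_fun setT g -> (forall x, 0 <= g x)%E ->
  (\int[m]_x (f x * \int[T x]_y g y) = \int[m]_x (g x * \int[S x]_y f y))%E.

Definition invariant_set m T (A : set E) : Prop :=
  {ae m, forall x, T x A = (\1_A x)%:E}.

Definition fixed_fun m T u : Prop :=
  {ae m, forall x, (\int[T x]_y (u y)%:E = (u x)%:E)%E}.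

(* Where u is zero, mass may be lost: this matches the extension of functions
   by zero to the cemetery. *)
Definition stationary m T u : Prop :=
  {ae m, forall x, T x [set y | u y != u x] = 0%E /\
                   (u x != 0 -> T x setT = 1%E)}.

(** What the stationarity argument needs from L^p: a condition free of [p] that makes sense when [m]
    is infinite and [u] is not integrable. *)
Definition small_tails m u : Prop :=
  forall c : R, 0 < c -> (\int[m]_x (Num.max 0 (`|u x| - c))%:E < +oo)%E.

Lemma measurable_kernel_integral T (f : E -> \bar R) : submarkov_kernel T ->
  measurable_fun setT f -> (forall x, 0 <= f x)%E ->
  measurable_fun setT (fun x => \int[T x]_y f y)%E.
Proof. by move=> [mT _] mf f0; exact: measurable_fun_integral_kernel. Qed.

Lemma submarkov_fin T x A : submarkov_kernel T -> measurable A ->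
  T x A \is a fin_num.
Proof.
move=> [_ T1] mA; rewrite ge0_fin_numE//.
apply: le_lt_trans (ltry 1); apply: le_trans (T1 x).
by apply: le_measure; rewrite ?inE.
Qed.

Lemma submarkov_le1 T x A : submarkov_kernel T -> measurable A ->
  (T x A <= 1)%E.
Proof.
move=> [_ T1] mA; apply: le_trans (T1 x).
by apply: le_measure; rewrite ?inE.
Qed.

Lemma in_duality_sym m T S : in_duality m T S -> in_duality m S T.
Proof. by move=> H f g mf f0 mg g0; rewrite (H g f). Qed.

(** With the constant 1 as second function, duality reads [m(S f) = m(f T1)], and [T1 <= 1]. *)
Lemma in_duality_subinvariant m T S :
  submarkov_kernel T -> submarkov_kernel S -> in_duality m T S ->
  subinvariant m S.
Proof.
move=> sT sS TS f mf f0.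
have := TS f (cst 1%E) mf f0 (measurable_cst _) (fun=> lee01).
under [in RHS]eq_integral do rewrite mul1e.
move=> <-; apply: ge0_le_integral => //.
- by move=> x _; apply: mule_ge0 => //; apply: integral_ge0.
- apply: emeasurable_funM => //.
  by apply: measurable_kernel_integral => //.
- move=> x _; rewrite integral_cst// mul1e -[leRHS]mule1.
  by apply: lee_pmul => //; exact: sT.2.
Qed.

(** A null set [N] satisfies [m(T 1_N) <= m(N) = 0]. Hence changing a function on a null set is
    invisible to [T x] for almost every [x]. *)
Lemma subinvariant_ae m T (P : E -> Prop) :
  submarkov_kernel T -> subinvariant m T ->
  {ae m, forall x, P x} -> {ae m, forall x, {ae T x, forall y, P y}}.
Proof.
move=> sT mT [N [mN N0 PN]].
have H : (\int[m]_x `|T x N| = 0)%E.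
  apply/eqP; rewrite eq_le; apply/andP; split; last exact: integral_ge0.
  have := mT (fun x => (\1_N x)%:E).
  rewrite integral_indic// setIT N0.
  under eq_integral do rewrite integral_indic// setIT.
  under [X in _ -> (X <= 0)%E]eq_integral do rewrite gee0_abs//.
  by apply => //; exact/measurable_EFinP.
have := (ae_eq_integral_abs m measurableT (sT.1 N mN)).1 H.
apply: filterS => x /(_ I) /= TxN.
by exists N.
Qed.

(** Almost every [x] satisfies the invariance equations at all nonzero rational levels at once, and
    any [y] with [u y <> u x] is separated from [x] by one of these levels. *)
Lemma level_sets_stationary m T u : submarkov_kernel T ->
  measurable_fun setT u ->
  (forall c : R, 0 < c -> invariant_set m T [set x | c < u x]) ->
  (forall c : R, 0 < c -> invariant_set m T [set x | c < - u x]) ->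
  stationary m T u.
Proof.
move=> sT mu up un.
have mgt c : measurable [set x | c < u x].
  by rewrite -[X in measurable X]setTI; exact: measurable_fun_ltr.
have mlt c : measurable [set x | u x < c].
  by rewrite -[X in measurable X]setTI; exact: measurable_fun_ltr.
have mle c : measurable [set x | u x <= c].
  by rewrite -[X in measurable X]setTI; exact: measurable_fun_ler.
have mge c : measurable [set x | c <= u x].
  by rewrite -[X in measurable X]setTI; exact: measurable_fun_ler.
have ltN c : [set x | c < - u x] = [set x | u x < - c].
  by apply/seteqP; split => x /=; rewrite ltrNr.
have pos : {ae m, forall x, forall q : rat, 0 < q ->
    T x [set y | ratr q < u y] = (\1_[set y | ratr q < u y] x : R)%:E}.
  apply: ae_rat => q; have [q0|q0] := ltP 0 q; last first.
    exact: aeW.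
  have qR : 0 < ratr q :> R by rewrite ltr0q.
  by have := up _ qR; rewrite /invariant_set; apply: filterS => x.
have neg : {ae m, forall x, forall q : rat, q < 0 ->
    T x [set y | u y < ratr q] = (\1_[set y | u y < ratr q] x : R)%:E}.
  apply: ae_rat => q; have [q0|q0] := ltP q 0; last first.
    exact: aeW.
  have qR : 0 < - ratr q :> R by rewrite oppr_gt0 ltrq0.
  by have := un _ qR; rewrite /invariant_set ltN opprK; apply: filterS => x.
apply: filterS2 pos neg => x Hp Hn.
(* Total mass is at most one, so the complement of a set of mass one is null. *)
have full A B : measurable A -> measurable B -> A `|` B = setT ->
    T x A = 1%E -> A `&` B = set0 -> T x B = 0%E.
  move=> mA mB AB TA dAB.
  have TU : T x setT = (1 + T x B)%E by rewrite -TA -AB measureU.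
  have := sT.2 x; rewrite TU -[leRHS]adde0 leeD2lE//.
  by move=> TB; apply/eqP; rewrite eq_le TB/=.
(* [B q] is the side of level [q] that does not contain [x]; it is empty at 0, where the hypotheses
   say nothing. Every [y] with [u y <> u x] lies in some [B q]. *)
pose B (q : rat) : set E :=
  if 0 < q then if ratr q < u x then [set y | u y <= ratr q]
                else [set y | ratr q < u y]
  else if q < 0 then if u x < ratr q then [set y | ratr q <= u y]
                     else [set y | u y < ratr q]
  else set0.
have mB q : measurable (B q).
  by rewrite /B; case: ifP => _; [|case: ifP => _ //]; case: ifP.
have B0 q : T x (B q) = 0%E.
  rewrite /B; case: ifPn => [q0|_].
    have := Hp q q0; case: ifPn => qx.
      rewrite indicE mem_set// => Tq; apply: (full _ _ _ _ _ Tq) => //.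
      - by apply/seteqP; split => // y _ /=; case: (ltP (ratr q) (u y)); [left|right].
      - by apply/seteqP; split => // y [/=]; rewrite ltNge => /negP.
    by rewrite indicE memNset//; exact/negP.
  case: ifPn => [q0|_]; last by rewrite measure0.
  have := Hn q q0; case: ifPn => qx.
    rewrite indicE mem_set// => Tq; apply: (full _ _ _ _ _ Tq) => //.
    - by apply/seteqP; split => // y _ /=; case: (ltP (u y) (ratr q)); [left|right].
    - by apply/seteqP; split => // y [/=]; rewrite ltNge => /negP.
  by rewrite indicE memNset//; exact/negP.
split.
  have mN : measurable [set y | u y != u x].
    rewrite (_ : mkset _ = [set y | u y < u x] `|` [set y | u x < u y]).
      exact: measurableU.
    by apply/seteqP; split => y /=; rewrite neq_lt => /orP.
  apply/negligibleP => //.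
  have : {ae T x, forall y, forall q, ~ B q y}.
    by apply: ae_rat => q; exists (B q); split => // y /= /contrapT.
  apply: negligibleS => y /=; rewrite neq_lt => yx /(_ _) yB.
  suff [q /yB] : exists q, B q y by [].
  case/orP : yx => /rat_between_neq0 [q [q0 q1 q2]]; exists q; rewrite /B.
    case: ifPn => [q3|]; first by rewrite q2/= ltW.
    rewrite -leNgt le_eqVlt (negPf q0)/= => ->.
    by rewrite ltNge (ltW q2).
  case: ifPn => [q3|]; first by rewrite ltNge (ltW q1).
  by rewrite -leNgt le_eqVlt (negPf q0)/= => ->; rewrite q1/= ltW.
(* A rational strictly between 0 and [u x] gives a level set containing [x], and this set has mass
   one. *)
move=> ux0; apply/eqP; rewrite eq_le (sT.2 x)/=.
move: ux0; rewrite neq_lt => /orP[] /rat_between_neq0[q [q0 q1 q2]].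
  have [q3|q3] := ltP q 0; last first.
    by move: q2; rewrite ltrq0 ltNge q3.
  have := Hn q q3; rewrite indicE mem_set// => <-.
  by apply: le_measure; rewrite ?inE.
have := Hp q; rewrite -(ltr0q R) => /(_ q1); rewrite indicE mem_set// => <-.
by apply: le_measure; rewrite ?inE.
Qed.

Lemma subset_null {mu : {measure set E -> \bar R}} (A B : set E) :
  measurable A -> measurable B -> A `<=` B -> mu B = 0%E -> mu A = 0%E.
Proof. by move=> mA mB AB B0; exact: subset_measure0 AB B0. Qed.

Lemma measurable_neq_cst u a : measurable_fun setT u ->
  measurable [set y | u y != a].
Proof.
move=> mu; rewrite (_ : mkset _ = ~` (u @^-1` [set a])).
  by apply: measurableC; rewrite -[X in measurable X]setTI; exact: mu.
by apply/seteqP; split => y /= /eqP.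
Qed.

(** The condition [phi 0 = 0] ensures that full mass is required only at points where [u] is
    nonzero. *)
Lemma stationary_comp m T u (phi : R -> R) : measurable_fun setT u ->
  measurable_fun setT phi -> phi 0 = 0 ->
  stationary m T u -> stationary m T (phi \o u).
Proof.
move=> mu mphi phi0; apply: filterS => x [Tu T1]; split.
  apply: subset_null Tu.
  - by apply: measurable_neq_cst; exact: measurableT_comp.
  - exact: measurable_neq_cst.
  - by move=> y /=; apply: contra => /eqP ->.
by move=> phiux; apply: T1; apply: contra phiux => /eqP /= ->; rewrite phi0.
Qed.

Lemma stationary_invariant m T u (B : set R) : submarkov_kernel T ->
  measurable_fun setT u -> measurable B -> ~ B 0 ->
  stationary m T u -> invariant_set m T (u @^-1` B).
Proof.
move=> sT mu mB B0; apply: filterS => x [Tu T1].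
have muB : measurable (u @^-1` B).
  by rewrite -[X in measurable X]setTI; exact: mu.
have mne := measurable_neq_cst u (u x) mu.
have [Bx|Bx] := pselect (B (u x)); last first.
  rewrite indicE memNset//; apply: subset_null Tu => //.
  by move=> y /= By; apply/eqP => yx; apply: Bx; rewrite -yx.
rewrite indicE mem_set//=.
have /T1 TxT : u x != 0 by apply/eqP => ux0; apply: B0; rewrite -ux0.
apply/eqP; rewrite eq_le submarkov_le1//=.
have TC : T x (~` (u @^-1` B)) = 0%E.
  apply: subset_null Tu => //; first exact: measurableC.
  by move=> y /= By; apply/eqP => yx; apply: By; rewrite yx.
have <- : T x setT = T x (u @^-1` B).
  rewrite -(setUv (u @^-1` B)) measureU ?setICr//; last exact: measurableC.
  by rewrite [X in (_ + X)%E]TC adde0.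
by rewrite TxT.
Qed.

(** The integrand is [T x]-almost surely the constant [u x], and mass can be missing only where this
    constant is zero. *)
Lemma stationary_fixed m T u : measurable_fun setT u ->
  stationary m T u -> fixed_fun m T u.
Proof.
move=> mu; apply: filterS => x [Tu T1].
rewrite (@ae_eq_integral _ _ _ _ _ (cst (u x)%:E))//; first last.
- exists [set y | u y != u x]; split => //; first exact: measurable_neq_cst.
  by move=> y /= /not_implyP[_ /eqP]; apply: contra => /eqP ->.
- exact/measurable_EFinP.
rewrite integral_cst//; have [->|/T1 ->] := eqVneq (u x) 0; first by rewrite mul0e.
by rewrite mule1.
Qed.

(** Duality with both functions equal to [1_A] gives that the integral of [S x A] over [A] is [m A].
    As [S x A <= 1] and [m A] is finite, [S x A = 1] almost everywhere on [A]. This already uses up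
    the bound [m(S 1_A) <= m A], so [S x A = 0] almost everywhere off [A]. *)
Lemma invariant_set_dual m T S (A : set E) :
  submarkov_kernel T -> submarkov_kernel S -> in_duality m T S ->
  measurable A -> (m A < +oo)%E ->
  invariant_set m T A -> invariant_set m S A.
Proof.
move=> sT sS TS mA mAoo TA.
have mI : measurable_fun setT (fun x => (\1_A x : R)%:E).
  by apply/measurable_EFinP.
have I0 x : (0 <= (\1_A x : R)%:E)%E by rewrite lee_fin.
have mSA := sS.1 A mA.
have intA : (\int[m]_x (\1_A x)%:E = m A)%E by rewrite integral_indic// setIT.
have H : (\int[m]_x ((\1_A x)%:E * S x A) = m A)%E.
  have := TS _ _ mI I0 mI I0.
  under eq_integral do rewrite integral_indic// setIT.
  under [in RHS]eq_integral do rewrite integral_indic// setIT.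
  move=> <-; rewrite -intA; apply: ae_eq_integral => //.
    by apply: emeasurable_funM => //; exact: sT.1.
  move: TA; rewrite /invariant_set; apply: filterS => x -> _.
  by rewrite -EFinM indicE; case: (_ \in _); rewrite ?mulr1 ?mulr0.
have SA1 : {ae m, forall x, (\1_A x)%:E = ((\1_A x)%:E * S x A)%E}.
  apply: (@ae_le_integral_eq _ _ _ m (fun x => ((\1_A x)%:E * S x A)%E)) => //.
  - exact: emeasurable_funM.
  - by apply: aeW => x; rewrite -[leRHS]mule1; apply: lee_pmul => //; exact: submarkov_le1.
  - by rewrite H intA.
  - by rewrite H.
apply: (@ae_le_integral_eq _ _ _ m (fun x => (\1_A x)%:E)) => //.
- move: SA1; apply: filterS => x ->; rewrite -[leRHS]mul1e.
  by apply: lee_pmul => //; rewrite lee_fin indicE; case: (_ \in _).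
- have := in_duality_subinvariant _ _ _ sT sS TS _ mI I0.
  by under eq_integral do rewrite integral_indic// setIT.
- by rewrite intA.
Qed.

(** Markov's inequality with the tail at [c / 2], which is at least [c / 2] on the set; the tail at
    [c] has no positive lower bound there. *)
Lemma small_tails_level m u (c : R) : measurable_fun setT u ->
  small_tails m u -> 0 < c -> (m [set x | (c < `|u x|)%R] < +oo)%E.
Proof.
move=> mu tu c0; set A := [set x | _].
have mA : measurable A.
  rewrite -[X in measurable X]setTI; apply: measurable_fun_ltr => //.
  exact: measurableT_comp.
have c20 : 0 < c / 2 by rewrite divr_gt0.
have mtail : measurable_fun setT (fun x => (Num.max 0 (`|u x| - c / 2))%:E).
  apply/measurable_EFinP; apply: measurable_maxr => //.
  by apply: measurable_funB => //; exact: measurableT_comp.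
have : ((c / 2)%:E * m A <= \int[m]_x (Num.max 0 (`|u x| - c / 2))%:E)%E.
  rewrite -integral_cst// integral_mkcond; apply: ge0_le_integral => //.
  - by move=> x _; apply: erestrict_ge0 => y _; rewrite lee_fin ltW.
  - by apply/(measurable_restrictT _ _).1 => //.
  - move=> x _; rewrite patchE; case: ifPn; rewrite ?inE /A/= => Ax.
      by rewrite lee_fin le_max; apply/orP; right; lra.
    by rewrite lee_fin le_max lexx.
move=> /le_lt_trans /(_ (tu _ c20)).
by rewrite -lte_pdivlMl// => /lt_le_trans; apply; rewrite leey.
Qed.

(** The integral is the extended difference of those of the positive and negative parts, and such a
    difference is finite only if both terms are. *)
Lemma integrable_fin (mu : {measure set E -> \bar R}) u : measurable_fun setT u ->
  (\int[mu]_y (u y)%:E)%E \is a fin_num -> mu.-integrable setT (EFin \o u).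
Proof.
move=> mu_; rewrite integralE.
have mE : measurable_fun setT (EFin \o u) by exact/measurable_EFinP.
have p0 : (0 <= \int[mu]_x ((EFin \o u)^\+ x))%E by exact: integral_ge0.
have n0 : (0 <= \int[mu]_x ((EFin \o u)^\- x))%E by exact: integral_ge0.
rewrite fin_numB => /andP[pf nf]; apply/integrableP; split => //.
have -> : (\int[mu]_x `|(EFin \o u) x| =
    \int[mu]_x ((EFin \o u)^\+ x) + \int[mu]_x ((EFin \o u)^\- x))%E.
  rewrite -ge0_integralD//; [|exact: measurable_funepos|exact: measurable_funeneg].
  by apply: eq_integral => x _; rewrite -/((abse \o (EFin \o u)) x) fune_abse.
by rewrite lte_add_pinfty// ltey_eq ?pf ?nf.
Qed.

(** Integration of [(u - c)^+ = (u - c) + (c - u)^+]: here [r] is the total mass and [N] the mean of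
    [(c - u)^+]. For [c >= 0] the result is at least [u x - c]. *)
Lemma fixed_excess T u (c : R) x : submarkov_kernel T -> measurable_fun setT u ->
  (\int[T x]_y (u y)%:E = (u x)%:E)%E ->
  exists r N : R, [/\ T x setT = r%:E, r <= 1,
    (\int[T x]_y (Num.max 0 (c - u y))%:E = N%:E)%E, 0 <= N &
    (\int[T x]_y (Num.max 0 (u y - c))%:E = (u x - c * r + N)%:E)%E].
Proof.
move=> sT mu Tu.
have Iu : (T x).-integrable setT (EFin \o u).
  by apply: integrable_fin => //; rewrite Tu.
have Ic k : (T x).-integrable setT (EFin \o cst k).
  apply/integrableP; split; first exact/measurable_EFinP/measurable_cst.
  rewrite /=; under eq_integral do rewrite /=.
  by rewrite integral_cst// lte_mul_pinfty//; apply: le_lt_trans (sT.2 x) (ltry _).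
have mn : measurable_fun setT (fun y => Num.max 0 (c - u y)).
  by apply: measurable_maxr => //; exact: measurable_funB.
have In : (T x).-integrable setT (EFin \o (fun y => Num.max 0 (c - u y))).
  apply: (@le_integrable _ _ _ _ _ measurableT _ ((EFin \o cst `|c|%R) \+ (abse \o (EFin \o u)))%E).
  - exact/measurable_EFinP.
  - move=> y _.
    suff: (`|Num.max 0 (c - u y)| <= `|(`|c| + `|u y|)|)%R by [].
    rewrite ger0_norm ?le_max ?lexx//.
    rewrite [leRHS]ger0_norm ?addr_ge0// ge_max addr_ge0//=.
    by rewrite (le_trans (ler_norm _))// ler_normB.
  - by apply: integrableD => //; exact: integrable_abse.
have TTfin : T x setT \is a fin_num by exact: submarkov_fin.
have nfin := integrable_fin_num measurableT In.
exists (fine (T x setT)), (fine (\int[T x]_y (Num.max 0 (c - u y))%:E)).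
have n0 : (0 <= \int[T x]_y (Num.max 0 (c - u y))%:E)%E.
  by apply: integral_ge0 => y _; rewrite lee_fin le_max lexx.
split; rewrite ?fineK//.
- by rewrite -lee_fin fineK//; exact: sT.2.
- exact: fine_ge0.
- rewrite EFinD EFinB EFinM !fineK// -Tu -integral_cst//.
  have IB := integrableB measurableT Iu (Ic c).
  rewrite -(integralB measurableT Iu (Ic c)) -(integralD measurableT IB In).
  apply: eq_integral => y _ /=; rewrite -EFinD; congr EFin.
  by case: (leP 0 (u y - c)); case: (leP 0 (c - u y)); lra.
Qed.

(** Put [g = (u - c)^+]. By [fixed_excess] and sub-invariance, [T g = g] almost everywhere. Where
    [u x > c] this says [c (1 - r) + N = 0], so no mass is lost and none lies below [c]; where
    [u x <= c] it says [T g = 0], so none lies above [c]. The mass on [u = c] seen from [u x > c] is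
    left undecided. *)
Lemma fixed_half_levels m T u (c : R) : submarkov_kernel T -> subinvariant m T ->
  measurable_fun setT u -> 0 < c ->
  (\int[m]_x (Num.max 0 (u x - c))%:E < +oo)%E -> fixed_fun m T u ->
  {ae m, forall x, (c < u x -> T x setT = 1%E /\ T x [set y | u y < c] = 0%E) /\
                   (u x <= c -> T x [set y | c < u y] = 0%E)}.
Proof.
move=> sT mT mu c0 fin fixu.
pose g y := Num.max 0 (u y - c).
have mg : measurable_fun setT (EFin \o g).
  apply/measurable_EFinP.
  by apply: measurable_maxr => //; exact: measurable_funB.
have g0 y : (0 <= (EFin \o g) y)%E by rewrite lee_fin le_max lexx.
have mn : measurable_fun setT (fun y => (Num.max 0 (c - u y))%:E).
  apply/measurable_EFinP.
  by apply: measurable_maxr => //; exact: measurable_funB.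
have n0 y : (0 <= (Num.max 0 (c - u y))%:E)%E by rewrite lee_fin le_max lexx.
have null h : measurable_fun setT h -> (forall y, 0 <= h y)%E -> forall x,
    (\int[T x]_y h y = 0)%E -> T x [set y | (0 < h y)%E] = 0%E.
  move=> mh h0 x Th.
  have mA : measurable [set y | (0 < h y)%E].
    by rewrite -[X in measurable X]setTI; exact: emeasurable_fun_o_infty.
  apply/negligibleP => //.
  have := (ae_eq_integral_abs (T x) measurableT mh).1.
  under eq_integral do rewrite gee0_abs//.
  move=> /(_ Th); apply: negligibleS => y /= hy; apply/not_implyP; split => //.
  by apply/eqP; rewrite gt_eqF.
have Tgg : {ae m, forall x, (\int[T x]_y (EFin \o g) y = (EFin \o g) x)%E}.
  apply: ae_le_integral_eq => //.
  - exact: measurable_kernel_integral.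
  - by move=> x; apply: integral_ge0.
  - move: fixu; rewrite /fixed_fun; apply: filterS => x.
    move=> /(fixed_excess T u c x sT mu)[r [N [Tr r1 _ N0 Tg]]].
    have : (0 <= \int[T x]_y (EFin \o g) y)%E by exact: integral_ge0.
    rewrite /= Tg !lee_fin /g ge_max => ->/=; nra.
  - exact: mT.
have mgt : measurable [set y | c < u y].
  by rewrite -[X in measurable X]setTI; exact: measurable_fun_ltr.
have mlt : measurable [set y | u y < c].
  by rewrite -[X in measurable X]setTI; exact: measurable_fun_ltr.
have setg : [set y | (0 < (EFin \o g) y)%E] = [set y | c < u y].
  by apply/seteqP; split => y /=; rewrite lte_fin /g lt_max ltxx/= subr_gt0.
have setn : [set y | (0 < (Num.max 0 (c - u y))%:E)%E] = [set y | u y < c].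
  by apply/seteqP; split => y /=; rewrite lte_fin lt_max ltxx/= subr_gt0.
move: fixu; rewrite /fixed_fun; apply: filterS2 Tgg => x Tg.
move=> /(fixed_excess T u c x sT mu)[r [N [Tr r1 TN N0 Tgr]]].
have : u x - c * r + N = g x by apply: EFin_inj; rewrite -Tgr; exact: Tg.
rewrite /g => H; split => cux.
  move: H; rewrite max_r ?subr_ge0 ?ltW// => H.
  have r1' : r = 1 by nra.
  have N0' : N = 0 by nra.
  rewrite Tr r1'; split => //; rewrite -setn.
  by apply: null => //; rewrite TN N0'.
rewrite -setg; apply: null => //.
by rewrite Tg /= /g max_l//; lra.
Qed.

(** The undecided mass on [u = c] is removed by using a slightly higher level [c + 1/(n+1)] that is
    still below [u x]. *)
Lemma fixed_level_sets m T u : submarkov_kernel T -> subinvariant m T ->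
  measurable_fun setT u -> small_tails m u -> fixed_fun m T u ->
  forall c : R, 0 < c -> invariant_set m T [set x | c < u x].
Proof.
move=> sT mT mu tu fixu c c0.
have mgt k : measurable [set y | k < u y].
  by rewrite -[X in measurable X]setTI; exact: measurable_fun_ltr.
have mlt k : measurable [set y | u y < k].
  by rewrite -[X in measurable X]setTI; exact: measurable_fun_ltr.
have mle k : measurable [set y | u y <= k].
  by rewrite -[X in measurable X]setTI; exact: measurable_fun_ler.
have tails k : 0 < k -> (\int[m]_x (Num.max 0 (u x - k))%:E < +oo)%E.
  move=> /tu; apply: le_lt_trans; apply: ge0_le_integral => //.
  - by move=> x _; rewrite lee_fin le_max lexx.
  - apply/measurable_EFinP; apply: measurable_maxr => //.
    exact: measurable_funB.
  - apply/measurable_EFinP; apply: measurable_maxr => //.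
    by apply: measurable_funB => //; exact: measurableT_comp.
  - move=> x _; rewrite lee_fin ge_max !le_max lexx/=; apply/orP; right.
    by rewrite lerB// ler_norm.
have half k : 0 < k -> _ := fun k0 => fixed_half_levels m T u k sT mT mu k0 (tails k k0) fixu.
have above : {ae m, forall x, forall n : nat, c + n.+1%:R^-1 < u x ->
    T x setT = 1%E /\ T x [set y | u y < c + n.+1%:R^-1] = 0%E}.
  apply: ae_foralln => n; have cn0 : 0 < c + n.+1%:R^-1 by rewrite addr_gt0.
  by apply: filterS (half _ cn0) => x [].
rewrite /invariant_set; apply: filterS2 above (half c c0) => x Hn [_ Hc].
have [uxc|uxc] := ltP c (u x); last first.
  by rewrite indicE memNset ?Hc//=; apply/negP; rewrite -leNgt.
rewrite indicE mem_set//=; rewrite -subr_gt0 in uxc.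
have [n nux] : exists n : nat, n.+1%:R^-1 < u x - c.
  exists (Num.truncn (u x - c)^-1).
  rewrite invf_plt ?posrE//; exact: truncnS_gt.
have [|T1 T0] := Hn n; first by rewrite -ltrBrDl.
have TC : T x [set y | u y <= c] = 0%E.
  apply: subset_null T0 => // y /= yc.
  by rewrite (le_lt_trans yc)// ltrDl.
rewrite -T1 (_ : setT = [set y | c < u y] `|` [set y | u y <= c]).
  rewrite measureU//; last first.
    by apply/seteqP; split => // y [/=]; rewrite ltNge => /negP.
  by rewrite [X in (_ + X)%E]TC adde0.
by apply/seteqP; split => // y _ /=; case: (ltP c (u y)); [left|right].
Qed.

Lemma fixed_funN m T u : submarkov_kernel T -> measurable_fun setT u ->
  fixed_fun m T u -> fixed_fun m T (fun x => - u x).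
Proof.
move=> sT mu; apply: filterS => x Tu.
have Iu : (T x).-integrable setT (EFin \o u).
  by apply: integrable_fin => //; rewrite Tu.
under eq_integral do rewrite EFinN.
rewrite integralN ?Tu ?EFinN//.
exact: integrable_add_def.
Qed.

Lemma fixed_stationary m T u : submarkov_kernel T -> subinvariant m T ->
  measurable_fun setT u -> small_tails m u -> fixed_fun m T u ->
  stationary m T u.
Proof.
move=> sT mT mu tu fixu; apply: level_sets_stationary => //.
  exact: fixed_level_sets.
apply: fixed_level_sets => //; first exact: measurableT_comp.
- by move=> c c0; under eq_integral do rewrite normrN; exact: tu.
- exact: fixed_funN.
Qed.

Lemma stationary_dual m T S u :
  submarkov_kernel T -> submarkov_kernel S -> in_duality m T S ->
  measurable_fun setT u -> small_tails m u ->
  stationary m T u -> stationary m S u.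
Proof.
move=> sT sS TS mu tu stu.
(* Sets [B] bounded away from 0 have preimages of finite measure, to which [invariant_set_dual]
   applies. *)
have dual (B : set R) : measurable B -> ~ B 0 ->
    (exists2 c : R, 0 < c & forall x, B (u x) -> c < `|u x|) ->
    invariant_set m S (u @^-1` B).
  move=> mB B0 [c c0 Bc].
  have muB : measurable (u @^-1` B).
    by rewrite -[X in measurable X]setTI; exact: mu.
  apply: (invariant_set_dual m T S _ sT sS TS muB).
    apply: le_lt_trans (small_tails_level m u c mu tu c0).
    apply: le_measure; rewrite ?inE//.
    rewrite -[X in measurable X]setTI; apply: measurable_fun_ltr => //.
    exact: measurableT_comp.
  exact: stationary_invariant.
apply: level_sets_stationary => // c c0.
- rewrite (_ : mkset _ = u @^-1` `]c, +oo[%classic); last first.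
    by apply/seteqP; split => x /=; rewrite in_itv/= andbT.
  apply: dual => //=; first by rewrite in_itv/= andbT => /lt_trans/(_ c0); rewrite ltxx.
  exists c => // x; rewrite in_itv/= andbT => /lt_le_trans; apply; exact: ler_norm.
- rewrite (_ : mkset _ = u @^-1` `]-oo, - c[%classic); last first.
    by apply/seteqP; split => x /=; rewrite in_itv/= ltrNr.
  apply: dual => //=; first by rewrite in_itv/= ltrNr oppr0 => /lt_trans/(_ c0); rewrite ltxx.
  exists c => // x; rewrite in_itv/= ltrNr => /lt_le_trans; apply.
  by rewrite -normrN ler_norm.
Qed.

(** Where [|u x| = t c] with [t >= 1], one has [(t - 1) c <= t c <= t^p c = (c / c^p) |u x|^p],
    which explains the constant; elsewhere the tail is zero. *)
Lemma Lfun_small_tails m u (p : R) : 1 <= p -> u \in Lfun m p%:E ->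
  small_tails m u.
Proof.
move=> p1 uLp c c0.
have := Lfun_integrable p1 uLp => /integrableP[mup].
under eq_integral do rewrite gee0_abs ?lee_fin ?powR_ge0//.
move=> fin.
have mu : measurable_fun setT u by move: uLp; rewrite inE => /andP[/[!inE]].
have k0 : 0 <= c / (c `^ p) by rewrite divr_ge0 ?powR_ge0// ltW.
apply: (@le_lt_trans _ _ (\int[m]_x ((c / (c `^ p))%:E * (`|u x| `^ p)%:E))%E).
  apply: ge0_le_integral => //.
  - by move=> x _; rewrite lee_fin le_max lexx.
  - apply/measurable_EFinP; apply: measurable_maxr => //.
    by apply: measurable_funB => //; exact: measurableT_comp.
  - exact: measurable_funeM.
  - move=> x _; rewrite lee_fin ge_max mulr_ge0 ?powR_ge0//=.
    have [uc|cu] := ltP `|u x| c.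
      by apply: (@le_trans _ _ 0); [lra|rewrite mulr_ge0 ?powR_ge0].
    have [t t1 ->] : exists2 t, 1 <= t & `|u x| = t * c.
      by exists (`|u x| / c); [rewrite ler_pdivlMr// mul1r|rewrite divfK// gt_eqF].
    rewrite powRM ?(ltW c0) ?(le_trans ler01 t1)//.
    rewrite mulrCA divfK ?gt_eqF ?powR_gt0//.
    apply: (@le_trans _ _ (t * c)); first by rewrite gerBl ltW.
    rewrite ler_wpM2r ?(ltW c0)// -[leLHS]powRr1 ?(le_trans ler01 t1)//.
    exact: ler_powR.
by rewrite ge0_integralZl// ?lte_mul_pinfty.
Qed.

(** From [|u| <= 1 + (|u| - 1)^+]: the constant has finite integral since [T x] has mass at most
    one, and the tail does for almost every [x] by sub-invariance. *)
Lemma kernel_abs_fin m T u : submarkov_kernel T -> subinvariant m T ->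
  measurable_fun setT u -> small_tails m u ->
  {ae m, forall x, (\int[T x]_y (`|u y|)%:E < +oo)%E}.
Proof.
move=> sT mT mu tu.
have mt : measurable_fun setT (fun x => (Num.max 0 (`|u x| - 1))%:E).
  apply/measurable_EFinP; apply: measurable_maxr => //.
  by apply: measurable_funB => //; exact: measurableT_comp.
have t0 x : (0 <= (Num.max 0 (`|u x| - 1))%:E)%E by rewrite lee_fin le_max lexx.
have fin : (\int[m]_x \int[T x]_y (Num.max 0 (`|u y| - 1))%:E < +oo)%E.
  by apply: le_lt_trans (tu 1 ltr01); exact: mT.
have I : m.-integrable setT (fun x => \int[T x]_y (Num.max 0 (`|u y| - 1))%:E)%E.
  apply: ge0_integrable => //; first exact: measurable_kernel_integral.
  by move=> x; exact: integral_ge0.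
move: (integrable_ae measurableT I); apply: filterS => x /(_ Logic.I).
rewrite fin_numElt => /andP[_ fx].
apply: (@le_lt_trans _ _ (\int[T x]_y (1 + (Num.max 0 (`|u y| - 1))%:E))%E).
  apply: ge0_le_integral => //.
  - by apply/measurable_EFinP; exact: measurableT_comp.
  - exact: emeasurable_funD.
  - by move=> y _; rewrite -EFinD lee_fin -lerBlDl le_max lexx orbT.
rewrite ge0_integralD// integral_cst// mul1e lte_add_pinfty//.
by apply: le_lt_trans (sT.2 x) (ltry _).
Qed.

End sub_markov.

Set Implicit Arguments.
Unset Strict Implicit.
Unset Printing Implicit Defensive.

(** * Laws of the position of a right process *)

Section lusin.
Context {R : realType} {d : measure_display} {E : measurableType d}.
Variables (O : set (set E)) (lusO : lusin_topology R O).

Lemma lusin_open_measurable (V : set E) : O V -> measurable V.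
Proof. by case: lusO => mE _ OV; rewrite mE; exact: sub_gen_smallest. Qed.

Lemma lusin_setT : O setT.
Proof.
case: lusO => _ [K [j [_ _ _ ->]]]; exists setT; last exact: preimage_setT.
exact: openT.
Qed.

Lemma lusin_setI : setI_closed O.
Proof.
case: lusO => _ [K [j [_ _ _ ->]]] _ _ [A oA <-] [B oB <-].
by exists (A `&` B); [exact: openI|rewrite preimage_setI].
Qed.

Definition open_continuous (f : E -> R) : Prop :=
  forall U : set R, open U -> O (f @^-1` U).

Lemma open_continuous_measurable f : open_continuous f -> measurable_fun setT f.
Proof.
move=> cf; apply: (measurability _ (RGenOpens.measurableE R)) => _ [_ [a [b ->] <-]].
rewrite setTI; apply: lusin_open_measurable; apply: cf; exact: interval_open.
Qed.

(* The distance to the complement of an open set, squeezed into [0, 1] by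
   contract, is positive exactly on that set. *)
Lemma lusin_open_approx (V : set E) : O V -> exists f : nat -> E -> R,
  [/\ forall n, open_continuous (f n),
      forall n x, 0 <= f n x <= 1 &
      forall x, f ^~ x @ \oo --> (\1_V x : R)].
Proof.
case: lusO => _ [K [j [_ _ _ OE]]]; rewrite {1}OE => -[W oW <-].
pose rho (z : K) : R := contract (edist_inf (~` W) z).
have rho_cont : continuous rho.
  move=> z; apply/cvgrPdist_lt => e e0.
  by have /cvg_ball /(_ e e0) := @edist_inf_continuous R K (~` W) z.
have rho01 z : 0 <= rho z <= 1.
  have := contract_le1 (edist_inf (~` W) z); rewrite ler_norml => /andP[_ ->].
  rewrite andbT -[leLHS](@contract0 R) /rho le_contract.
  exact: edist_inf_ge0.
have rho0 z : ~ W z -> rho z = 0.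
  by move=> Wz; rewrite /rho edist_inf0//= mul0r.
have rho_gt0 z : W z -> 0 < rho z.
  move=> Wz; rewrite -[ltLHS](@contract0 R) /rho lt_contract.
  have [e /= e0 eW] : nbhs_ball z W by rewrite nbhs_ballE; exact: open_nbhs_nbhs.
  apply: (@lt_le_trans _ _ e%:E); first by rewrite lte_fin.
  apply: le_ereal_inf_tmp => _ [a Wa <-]; rewrite leNgt; apply/negP.
  by move=> /edist_lt_ball /= /eW.
(* As [n] grows, [1 - (1 - r) ^+ n] tends to 1 for [0 < r <= 1] and stays 0 for [r = 0]. *)
exists (fun n x => 1 - (1 - rho (j x)) ^+ n); split.
- move=> n U oU; rewrite OE.
  exists ((fun z => 1 - (1 - rho z) ^+ n) @^-1` U) => //.
  apply: open_comp => // z _.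
  apply: (@continuous_comp _ _ _ rho (fun y : R => 1 - (1 - y) ^+ n)).
    exact: rho_cont.
  apply: (@cvgB _ R^o); first exact: cvg_cst.
  apply: (@continuous_comp _ _ _ (fun y : R => 1 - y) (fun y : R => y ^+ n)).
    by apply: (@cvgB _ R^o); [exact: cvg_cst|exact: cvg_id].
  exact: exprn_continuous.
- move=> n x; have /andP[r0 r1] := rho01 (j x).
  rewrite subr_ge0 exprn_ile1 ?subr_ge0//=; last by lra.
  by rewrite gerBl exprn_ge0// subr_ge0.
- move=> x; rewrite indicE; have [Wx|Wx] := pselect (W (j x)).
    rewrite mem_set//= -[X in _ --> X]subr0; apply: cvgB; first exact: cvg_cst.
    apply: cvg_expr; have /andP[r0 r1] := rho01 (j x); have := rho_gt0 _ Wx.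
    by rewrite ger0_norm ?subr_ge0//; lra.
  rewrite memNset//= rho0// subr0; apply: cvg_near_cst; apply: nearW => n.
  by rewrite expr1n subrr.
Qed.

End lusin.

(** * One-time laws and lifetime of a Markov process *)

Section process_lemmas.
Context {R : realType} {d d' : measure_display}.
Context {E : measurableType d} {Om : measurableType d'}.
Variable Z : process R E Om.

Lemma along_Some (V : nmodType) (f : E -> V) t w y : state Z t w = Some y ->
  along Z f t w = f y.
Proof. by rewrite /along => ->. Qed.

Lemma along_None (V : nmodType) (f : E -> V) t w : state Z t w = None ->
  along Z f t w = 0.
Proof. by rewrite /along => ->. Qed.

Lemma visitsP t (B : set E) w :
  visits Z t B w <-> exists2 y, state Z t w = Some y & B y.
Proof. by split => [[y By yE]|[y yE By]]; exists y. Qed.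

Lemma visits_Some t (B : set E) w y : state Z t w = Some y ->
  visits Z t B w = B y.
Proof.
move=> yE; apply/propext; rewrite visitsP; split => [[z]|By]; last by exists y.
by rewrite yE => -[->].
Qed.

Lemma visits_None t (B : set E) w : state Z t w = None -> ~ visits Z t B w.
Proof. by rewrite visitsP => -> []. Qed.

Lemma visits_bigcup t (F : (set E)^nat) :
  visits Z t (\bigcup_n F n) = \bigcup_n visits Z t (F n).
Proof.
apply/seteqP; split => w.
  by move=> [y [n _ Fny] yE]; exists n => //; exists y.
by move=> [n _ [y Fny yE]]; exists y => //; exists n.
Qed.

Lemma visits_trivIset t (F : (set E)^nat) : trivIset setT F ->
  trivIset setT (fun n => visits Z t (F n)).
Proof.
move=> tF; apply/trivIsetP => i j _ _ ij; apply/seteqP; split => // w [].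
move=> [y Fiy yE] [z Fjz]; rewrite -yE => -[zy].
have : (F i `&` F j) y by split => //; rewrite -zy.
by move/trivIsetP : tF => /(_ i j I I ij) ->.
Qed.

(** Functions vanish at the cemetery, so dead paths belong to the preimage exactly when [S] contains
    0; taking a complement expresses this through visits alone. *)
Lemma along_preimage (V : nmodType) (f : E -> V) t (S : set V) :
  along Z f t @^-1` S = if `[< S 0 >] then ~` visits Z t (f @^-1` (~` S))
                        else visits Z t (f @^-1` S).
Proof.
apply/seteqP; case: ifPn => /asboolP S0; split => w;
  (case yE : (state Z t w) => [y|];
    [rewrite /= (visits_Some _ yE) /= (along_Some _ yE)|
     rewrite /= (along_None _ yE)]) => //.
- by move=> fyS /(_ fyS).
- by move=> _; exact: visits_None.
- exact: contrapT.
- by move=> /(visits_None yE).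
Qed.

Hypothesis mZ : markov_process Z.

Lemma visits_measurable t (B : set E) : 0 <= t -> measurable B ->
  measurable (visits Z t B).
Proof.
move=> t0 mB; have [_ ] := filt_sigma_algebra mZ t0; apply.
exact: path_adapted.
Qed.

Lemma along_adapted (V : nmodType) (f : E -> V) t (S : set V) :
  0 <= t -> measurable (f @^-1` S) -> filt Z t (along Z f t @^-1` S).
Proof.
move=> t0 mS; rewrite along_preimage; case: ifPn => _; last exact: path_adapted.
have [[_ fC _] _] := filt_sigma_algebra mZ t0; rewrite -setTD; apply: fC.
by apply: path_adapted => //; rewrite preimage_setC; exact: measurableC.
Qed.

Lemma measurable_along_ereal (f : E -> \bar R) t : 0 <= t ->
  measurable_fun setT f -> measurable_fun setT (along Z f t).
Proof.
move=> t0 mf _ S mS; rewrite setTI.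
have [_ ] := filt_sigma_algebra mZ t0; apply; apply: along_adapted => //.
by rewrite -[X in measurable X]setTI; exact: mf.
Qed.

Lemma measurable_along (f : E -> R) t : 0 <= t ->
  measurable_fun setT f -> measurable_fun setT (along Z f t).
Proof.
move=> t0 mf _ S mS; rewrite setTI.
have [_ ] := filt_sigma_algebra mZ t0; apply; apply: along_adapted => //.
by rewrite -[X in measurable X]setTI; exact: mf.
Qed.

Lemma along_EFin (f : E -> R) t w : along Z (EFin \o f) t w = (along Z f t w)%:E.
Proof. by rewrite /along; case: (state Z t w). Qed.

(* Negative times are sent to 0 so that the kernel is indexed by the whole
   line. *)
Definition position of markov_process Z := fun (xt : E * R) (A : set E) =>
  law Z xt.1 (visits Z (Num.max 0 xt.2) A).

Let max_ge0 (t : R) : 0 <= Num.max 0 t. Proof. by rewrite le_max lexx. Qed.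

Let position0 xt : position mZ xt set0 = 0%E.
Proof.
rewrite /position (_ : visits _ _ _ = set0) ?measure0//.
by apply/seteqP; split => // w [].
Qed.

Let position_ge0 xt A : (0 <= position mZ xt A)%E.
Proof. exact: measure_ge0. Qed.

Let position_sigma_additive xt : semi_sigma_additive (position mZ xt).
Proof.
move=> F mF tF mUF; rewrite /position visits_bigcup.
apply: measure_semi_sigma_additive.
- by move=> n; exact: visits_measurable.
- exact: visits_trivIset.
- by rewrite -visits_bigcup; exact: visits_measurable.
Qed.

HB.instance Definition _ xt := isMeasure.Build _ _ R (position mZ xt)
  (position0 xt) (position_ge0 xt) (@position_sigma_additive xt).

Definition position_measure (xt : E * R) : {measure set E -> \bar R} :=
  position mZ xt.

(** The position measure is the image under [phi] of the law restricted to paths alive at [t]. The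
    value [point] given to dead paths carries no mass, and [along] is 0 on them. *)
Lemma integral_position x t (f : E -> \bar R) : 0 <= t ->
  measurable_fun setT f -> (forall y, 0 <= f y)%E ->
  (\int[position_measure (x, t)]_y f y = \int[law Z x]_w along Z f t w)%E.
Proof.
move=> t0 mf f0.
pose phi w := odflt point (state Z t w).
pose D := visits Z t setT.
have mD : measurable D by exact: visits_measurable.
have phiE w : D w -> state Z t w = Some (phi w).
  by rewrite /D /phi => /visitsP[y ->].
have mphi : measurable_fun setT phi.
  move=> _ B mB; rewrite setTI.
  have -> : phi @^-1` B = visits Z t B `|` (~` D `&` [set _ | B point]).
    apply/seteqP; split => w; rewrite /D /phi /=.
      case yE : (state Z t w) => [y|] /= By; first by left; exists y.
      by right; split => //; exact: visits_None.
    move=> [/visitsP[y ->] //|]; case yE : (state Z t w) => [y|] /= [] //.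
    by rewrite (visits_Some _ yE) => /(_ I).
  apply: measurableU; first exact: visits_measurable.
  have [Bp|Bp] := pselect (B point).
    rewrite (_ : [set _ | _] = setT) ?setIT; first exact: measurableC.
    by apply/seteqP; split.
  rewrite (_ : [set _ | _] = set0) ?setI0//.
  by apply/seteqP; split.
transitivity (\int[pushforward (mrestr (law Z x) mD) phi]_y f y)%E.
  apply: eq_measure_integral => A mA _.
  rewrite /position_measure/= /position/= /pushforward/= /mrestr max_r//.
  congr (law Z x _); apply/seteqP; split => w.
    move=> [y Ay yE]; split; last by exists y.
    by rewrite /phi /= -yE.
  by move=> [Aw /phiE pE]; exists (phi w).
rewrite ge0_integral_pushforward//= preimage_setT.
have mfphi : measurable_fun setT (f \o phi) by exact: measurableT_comp.
rewrite (@ge0_negligible_integral _ _ _ _ _ (~` D))//; first last.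
- by rewrite /= /mrestr setICl measure0.
- exact: measurableC.
rewrite setTD setCK (@eq_measure_integral _ _ _ _ (law Z x)); last first.
  by move=> A mA AD; rewrite /= /mrestr setIidl.
rewrite integral_mkcond; apply: eq_integral => w _; rewrite patchE.
case: ifPn; rewrite ?inE ?notin_setE => Dw.
  by rewrite /= (along_Some _ (phiE w Dw)).
case yE : (state Z t w) => [y|]; last by rewrite (along_None _ yE).
by exfalso; apply: Dw; exists y.
Qed.

Lemma lt_lifetime_alive t w : 0 <= t -> (t%:E < lifetime Z w)%E ->
  state Z t w <> None.
Proof.
move=> t0 + tN; apply/negP; rewrite -leNgt.
by apply: ereal_inf_lbound; exists t.
Qed.

Lemma alive_le_lifetime t w : 0 <= t -> state Z t w <> None ->
  (t%:E <= lifetime Z w)%E.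
Proof.
move=> t0 tN; apply: le_ereal_inf_tmp => _ [s [s0 sN] <-].
rewrite lee_fin leNgt; apply/negP => st; apply: tN.
exact: (path_absorbed mZ s0 (ltW st) sN).
Qed.

(** By absorption, being alive slightly later than [t] is the same as [t < lifetime]; being alive at
    [t] itself gives only [t <= lifetime]. *)
Lemma lifetime_bigcup t : 0 <= t -> [set w | (t%:E < lifetime Z w)%E] =
  \bigcup_n visits Z (t + n.+1%:R^-1) setT.
Proof.
move=> t0; apply/seteqP; split => w /=.
  move=> tz; have [n tn] : exists n : nat, ((t + n.+1%:R^-1)%:E < lifetime Z w)%E.
    case: (lifetime Z w) tz => [z| |]//; last by exists 0%N; rewrite ltry.
    rewrite lte_fin -subr_gt0 => zt; exists (Num.truncn (z - t)^-1).
    by rewrite lte_fin -ltrBrDl invf_plt ?posrE//; exact: truncnS_gt.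
  exists n => //; have := lt_lifetime_alive _ tn.
  case yE : (state Z _ w) => [y|]; last by move=> H; exfalso; apply: H => //; rewrite addr_ge0.
  by move=> _; exists y.
move=> [n _ [y _ yE]]; apply: (@lt_le_trans _ _ (t + n.+1%:R^-1)%:E).
  by rewrite lte_fin ltrDl.
by apply: alive_le_lifetime; rewrite ?addr_ge0 -?yE.
Qed.

Lemma lifetime_measurable t : 0 <= t ->
  measurable [set w | (t%:E < lifetime Z w)%E].
Proof.
move=> t0; rewrite lifetime_bigcup//; apply: bigcupT_measurable => n.
by apply: visits_measurable => //; rewrite addr_ge0.
Qed.

End process_lemmas.

(** * Joint measurability of the one-time laws in space and time *)

Section right_process_lemmas.
Context {R : realType} {d d' : measure_display}.
Context {E : measurableType d} {Om : measurableType d'}.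
Variables (O : set (set E)) (Z : process R E Om).
Hypotheses (lusO : lusin_topology R O) (rZ : right_process O Z).
Let mZ := right_markov rZ.

(** The whole space is open, so right continuity keeps a path alive for some time after [t]. *)
Lemma alive_lt_lifetime x : {ae law Z x, forall w, forall t, 0 <= t ->
  state Z t w <> None -> (t%:E < lifetime Z w)%E}.
Proof.
move: (path_right_continuous rZ x); apply: filterS => w H t t0.
case yE : (state Z t w) => [y|//] _.
have Hs := H t y t0 yE setT (lusin_setT lusO) I.
have [s ts [z _ zE]] : exists2 s, t < s & visits Z s setT w.
  near t^'+ => s; exists s; first by near: s; exact: nbhs_right_gt.
  by near: s.
apply: (@lt_le_trans _ _ s%:E); first by rewrite lte_fin.
by apply: (alive_le_lifetime mZ); rewrite ?(le_trans t0 (ltW ts)) -?zE.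
Unshelve. all: by end_near. Qed.

(** The events [t < lifetime] and being alive at [t] agree almost surely, and [along] vanishes off
    the latter. *)
Lemma transitionE x t (f : E -> \bar R) : 0 <= t ->
  measurable_fun setT f -> (forall y, 0 <= f y)%E ->
  (transition Z t f x = \int[position_measure mZ (x, t)]_y f y)%E.
Proof.
move=> t0 mf f0; rewrite integral_position// /transition.
have ma := measurable_along_ereal mZ t0 mf.
have a0 w : (0 <= along Z f t w)%E by rewrite /along; case: (state Z t w).
have mL := lifetime_measurable mZ t0.
rewrite integral_mkcond; apply: ge0_ae_eq_integral => //.
- by apply/(measurable_restrictT _ _).1 => //; exact: measurable_funTS.
- by move=> w _; exact: erestrict_ge0.
- move: (alive_lt_lifetime x); apply: filterS => w H _; rewrite patchE.
  case: ifPn; rewrite ?notin_setE//= => tz.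
  case yE : (state Z t w) => [y|]; last by rewrite (along_None _ yE).
  by exfalso; apply: tz; apply: H => //; rewrite yE.
Qed.

Lemma open_continuous_along (f : E -> R) x : open_continuous O f ->
  {ae law Z x, forall w, forall t, 0 <= t ->
     along Z f s w @[s --> t^'+] --> along Z f t w}.
Proof.
move=> cf; move: (path_right_continuous rZ x); apply: filterS => w H t t0.
case yE : (state Z t w) => [y|]; last first.
  rewrite (along_None _ yE); apply: cvg_near_cst; near=> s.
  apply: along_None; apply: (path_absorbed mZ t0 _ yE).
  by apply: ltW; near: s; exact: nbhs_right_gt.
rewrite (along_Some _ yE) => U; rewrite nbhsE => -[U' [oU' U'y] U'U].
have := H t y t0 yE _ (cf _ oU') U'y; apply: filterS => s [z U'z zE].
by rewrite /= /along -zE; exact: U'U.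
Unshelve. all: by end_near. Qed.

(** The first multiple of [1/(n+1)] strictly above the positive part of [t]; strictness matters
    because limits along the paths are taken from the right. *)
Definition grid (n : nat) (t : R) : R :=
  (Num.truncn (Num.max 0 t * n.+1%:R)).+1%:R / n.+1%:R.

Lemma grid_gt n t : Num.max 0 t < grid n t.
Proof. by rewrite /grid ltr_pdivlMr// truncnS_gt. Qed.

Lemma grid_cvg t : grid ^~ t @ \oo --> Num.max 0 t.
Proof.
have t0 : 0 <= Num.max 0 t by rewrite le_max lexx.
apply: (@squeeze_cvgr _ _ _ _ (cst (Num.max 0 t))
  (fun n => Num.max 0 t + n.+1%:R^-1)).
- apply: nearW => n; rewrite (ltW (grid_gt _ _))/= /grid -nat1r mulrDl mul1r.
  rewrite addrC lerD2r ler_pdivrMr//.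
  by have /andP[] := truncn_itv (mulr_ge0 t0 (ler0n R n.+1)).
- exact: cvg_cst.
- by rewrite -[X in _ --> X]addr0; apply: cvgD; [exact: cvg_cst|exact: cvg_harmonic].
Qed.

Lemma measurable_glue (N : R -> nat) (g : nat -> E -> \bar R) :
  (forall k, measurable [set t | N t = k]) ->
  (forall k, measurable_fun setT (g k)) ->
  measurable_fun setT (fun xt : E * R => g (N xt.2) xt.1).
Proof.
move=> mN mg _ S mS; rewrite setTI.
have -> : (fun xt : E * R => g (N xt.2) xt.1) @^-1` S =
    \bigcup_k ((g k @^-1` S) `*` [set t | N t = k]).
  apply/seteqP; split => -[x t] /=; first by exists (N t).
  by move=> [k _ [/= Sx ->]].
apply: bigcupT_measurable => k; apply: measurableX => //.
by rewrite -[X in measurable X]setTI; exact: mg.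
Qed.

Lemma measurable_position_section t (f : E -> \bar R) :
  measurable_fun setT f -> (forall y, 0 <= f y)%E ->
  measurable_fun setT (fun x => \int[position_measure mZ (x, t)]_y f y)%E.
Proof.
move=> mf f0.
apply: (measurable_fun_integral_kernel (l := fun x => position_measure mZ (x, t))) => //.
move=> U mU; rewrite /position_measure/= /position/=.
by apply: (law_borel mZ) => //; rewrite le_max lexx.
Qed.

Lemma integral_position_max x t (f : E -> \bar R) :
  (\int[position_measure mZ (x, t)]_y f y =
   \int[position_measure mZ (x, (Num.max 0 t)%R)]_y f y)%E.
Proof.
apply: eq_measure_integral => A _ _; rewrite /position_measure/= /position/=.
by rewrite [in RHS]max_r// le_max lexx.
Qed.

(** At grid times the integral is piecewise constant in [t] and measurable in [x]. Right continuity
    of the paths and dominated convergence, with bound 1, pass to the limit in [n]. *)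
Lemma measurable_position_continuous (f : E -> R) : open_continuous O f ->
  (forall y, 0 <= f y <= 1) -> measurable_fun setT
    (fun xt => \int[position_measure mZ xt]_y (f y)%:E)%E.
Proof.
move=> cf f01.
have f0 y : (0 <= (f y)%:E)%E by rewrite lee_fin; case/andP : (f01 y).
have mf : measurable_fun setT (EFin \o f).
  by apply/measurable_EFinP; exact: open_continuous_measurable cf.
have t0 (t : R) : 0 <= Num.max 0 t by rewrite le_max lexx.
apply: (@emeasurable_fun_cvg _ _ _ _
  (fun n xt => \int[position_measure mZ (xt.1, grid n xt.2)]_y (f y)%:E)%E).
- move=> n.
  pose g k x := (\int[position_measure mZ (x, (k.+1%:R / n.+1%:R)%R)]_y (f y)%:E)%E.
  apply: (@measurable_glue (fun t => Num.truncn (Num.max 0 t * n.+1%:R)) g).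
    move=> k; pose c (t : R) := Num.max 0 t * n.+1%:R.
    have c0 t : 0 <= c t by rewrite mulr_ge0.
    have mc : measurable_fun setT c.
      by apply: measurable_funM => //; exact: measurable_maxr.
    rewrite (_ : mkset _ = c @^-1` `[k%:R, k.+1%:R[%classic).
      by rewrite -[X in measurable X]setTI; exact: mc.
    by apply/seteqP; split => t /=; rewrite in_itv/= -truncn_eq// => /eqP.
  by move=> k; exact: measurable_position_section.
- move=> [x t] _ /=; rewrite integral_position_max integral_position//.
  have gE n : (\int[position_measure mZ (x, grid n t)]_y (f y)%:E =
      \int[law Z x]_w along Z (EFin \o f) (grid n t) w)%E.
    by rewrite integral_position//; exact: le_trans (t0 t) (ltW (grid_gt _ _)).
  under eq_fun do rewrite gE.
  have [] // := @dominated_convergence _ _ _ (law Z x) setT measurableT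
    (fun n => along Z (EFin \o f) (grid n t))
    (along Z (EFin \o f) (Num.max 0 t)) (cst 1%E).
  + move=> n; apply: measurable_along_ereal => //.
    exact: le_trans (t0 t) (ltW (grid_gt _ _)).
  + exact: measurable_along_ereal.
  + move: (open_continuous_along x cf); apply: filterS => w H _.
    under eq_fun do rewrite along_EFin.
    rewrite along_EFin; apply: cvg_EFin; first exact: nearW.
    by apply: ((cvg_at_rightP _ _ _).1 (H _ (t0 t))); split;
      [move=> n; exact: grid_gt|exact: grid_cvg].
  + apply/integrableP; split => //.
    rewrite (eq_integral (cst 1%E)) => [|w _]; last by rewrite abse1.
    rewrite integral_cst// mul1e.
    exact: le_lt_trans (probability_le1 (law Z x) measurableT) (ltry 1).
  + apply: aeW => w n _; rewrite along_EFin abse_EFin lee_fin /along.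
    case: (state Z _ w) => [y|]/=; last by rewrite normr0.
    by have /andP[] := f01 y; move=> ? ?; rewrite ger0_norm.
Qed.

(** Indicators of open sets are limits of continuous functions; the open sets form a pi-system
    generating the sigma-algebra, and Dynkin induction does the rest. *)
Lemma measurable_position (B : set E) : measurable B ->
  measurable_fun setT (fun xt => position_measure mZ xt B).
Proof.
case: (lusO) => mE _; rewrite mE.
have fin xt A : measurable A -> position_measure mZ xt A \is a fin_num.
  move=> mA; rewrite ge0_fin_numE//.
  apply: le_lt_trans (probability_le1 (law Z xt.1) _) (ltry 1).
  by apply: visits_measurable => //; rewrite le_max lexx.
have opens V : O V -> measurable_fun setT (fun xt => position_measure mZ xt V).
  move=> OV; have [f [cf f01 f1]] := lusin_open_approx lusO OV.
  have mV := lusin_open_measurable lusO OV.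
  apply: (@emeasurable_fun_cvg _ _ _ _
      (fun n xt => \int[position_measure mZ xt]_y (f n y)%:E)%E).
    by move=> n; exact: measurable_position_continuous.
  move=> xt _.
  have <- : (\int[position_measure mZ xt]_y (\1_V y)%:E = position_measure mZ xt V)%E.
    by rewrite integral_indic// setIT.
  have [] // := @dominated_convergence _ _ _ (position_measure mZ xt) setT measurableT
    (fun n => EFin \o f n) (fun y => (\1_V y)%:E) (cst 1%E).
  + move=> n; apply/measurable_EFinP.
    exact: open_continuous_measurable (cf n).
  + exact/measurable_EFinP.
  + apply: aeW => y _; apply: cvg_EFin; first exact: nearW.
    exact: f1.
  + apply/integrableP; split => //.
    rewrite (eq_integral (cst 1%E)) => [|w _]; last by rewrite abse1.
    by rewrite integral_cst// mul1e; have := fin xt setT measurableT; rewrite ge0_fin_numE.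
  + apply: aeW => y n _; rewrite /= lee_fin.
    by have /andP[] := f01 n y; move=> ? ?; rewrite ger0_norm.
move: B; apply: (dynkin_induction (G := O)) => //.
- exact: lusin_setI lusO.
- exact: opens (lusin_setT lusO).
- move=> S mS IH.
  have -> : (fun xt => position_measure mZ xt (~` S)) =
      (fun xt => position_measure mZ xt setT - position_measure mZ xt S)%E.
    apply/funext => xt.
    rewrite -(setUv S) measureU ?setICr//; last exact: measurableC.
    by apply/esym; rewrite [LHS]addeAC subee ?fin// add0e.
  by apply: emeasurable_funB => //; exact: opens (lusin_setT lusO).
- move=> F mF tF IH.
  rewrite (_ : (fun xt => _) =
     (fun xt => \sum_(i <oo) position_measure mZ xt (F i))%E).
    by apply: ge0_emeasurable_sum => // *; exact: measure_ge0.
  by apply/funext => xt; rewrite measure_bigcup//; apply: eq_eseriesl => // i; rewrite in_setT.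
Qed.

End right_process_lemmas.

(** * The resolvent kernel *)

Section integral_bind.
Import HBNNSimple.
Context {R : realType} {d d' : measure_display}.
Context {X : measurableType d} {Y : measurableType d'}.
Variables (mu : {measure set X -> \bar R}) (nu : {measure set Y -> \bar R}).
Variable k : X -> {measure set Y -> \bar R}.
Hypothesis mk : forall A, measurable A -> measurable_fun setT (k ^~ A).
Hypothesis nuE : forall A, measurable A -> (nu A = \int[mu]_x k x A)%E.

Let integral_bind_nnsfun (h : {nnsfun Y >-> R}) :
  (\int[nu]_y (h y)%:E = \int[mu]_x \int[k x]_y (h y)%:E)%E.
Proof.
have hE (m : {measure set Y -> \bar R}) : (\int[m]_y (h y)%:E =
    \sum_(r \in range h) r%:E * m (h @^-1` [set r]))%E.
  under eq_integral do rewrite fimfunE -fsumEFin//.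
  rewrite ge0_integral_fsum//; last 2 first.
  - by move=> r; exact/measurable_EFinP/measurableT_comp.
  - by move=> r z _; rewrite EFinM nnfun_muleindic_ge0.
  apply: eq_fsbigr => r _; rewrite (integralZl_indic _ (fun r => h @^-1` [set r]))//.
    by rewrite integral_indic// setIT.
  by move=> r0; rewrite preimage_nnfun0.
under [in RHS]eq_integral do rewrite hE.
have mkr r : measurable_fun setT (k ^~ (h @^-1` [set r])) by exact: mk.
rewrite hE ge0_integral_fsum//; last 2 first.
- by move=> r; exact: measurable_funeM.
- by move=> r x _; have := mulemu_ge0 (fun r => h @^-1` [set r]); apply;
    exact: preimage_nnfun0.
apply: eq_fsbigr => r _; rewrite nuE//.
have [r0|r0] := ltP r 0; last by rewrite ge0_integralZl.
by under eq_integral do rewrite (preimage_nnfun0 h r0) measure0;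
  under [in RHS]eq_integral do rewrite (preimage_nnfun0 h r0) measure0 mule0;
  rewrite !integral0 mule0.
Qed.

(** Extends a mixture formula from sets to functions, through simple functions and monotone
    convergence. It serves both densities and the Chapman-Kolmogorov equation. *)
Lemma integral_bind (f : Y -> \bar R) : measurable_fun setT f ->
  (forall y, 0 <= f y)%E -> (\int[nu]_y f y = \int[mu]_x \int[k x]_y f y)%E.
Proof.
move=> mf f0.
pose f_ := nnsfun_approx measurableT mf.
have f_cvg y : (f_ n y)%:E @[n --> \oo] --> f y by exact: cvg_nnsfun_approx.
have f_nd y : {homo (fun n => (f_ n y)%:E) : m n / (m <= n)%N >-> (m <= n)%E}.
  by move=> m n mn; rewrite lee_fin; exact/lefP/nd_nnsfun_approx.
have mf_ n : measurable_fun setT (fun y => (f_ n y)%:E) by exact/measurable_EFinP.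
have f_0 n y : (0 <= (f_ n y)%:E)%E by rewrite lee_fin.
have limE (m : {measure set Y -> \bar R}) :
    (\int[m]_y f y = limn (fun n => \int[m]_y (f_ n y)%:E))%E.
  rewrite -monotone_convergence//.
  by apply: eq_integral => y _; apply/esym/cvg_lim.
rewrite limE (_ : (fun n => _) = (fun n => \int[mu]_x \int[k x]_y (f_ n y)%:E)%E);
  last by apply/funext => n; exact: integral_bind_nnsfun.
rewrite -monotone_convergence//.
- by apply: eq_integral => x _; rewrite limE.
- by move=> n; exact: measurable_fun_integral_kernel.
- by move=> n x _; exact: integral_ge0.
- by move=> x _ m n mn; apply: ge0_le_integral => // y _; exact: f_nd.
Qed.

End integral_bind.

Lemma integral_density {R : realType} {d} {E : measurableType d}
    (mu nu : {measure set E -> \bar R}) (w : E -> R) (g : E -> \bar R) :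
  measurable_fun setT w -> (forall x, 0 <= w x) ->
  (forall A, measurable A -> (nu A = \int[mu]_(x in A) (w x)%:E)%E) ->
  measurable_fun setT g -> (forall x, 0 <= g x)%E ->
  (\int[nu]_x g x = \int[mu]_x ((w x)%:E * g x))%E.
Proof.
move=> mw w0 nuE mg g0.
(* A measure with density [w] is the mixture of the point masses [w x] times the Dirac mass at
   [x]. *)
pose k x : {measure set E -> \bar R} := mscale (NngNum (w0 x)) (dirac x).
rewrite (@integral_bind _ _ _ _ _ mu nu k)//.
- apply: eq_integral => x _.
  by rewrite ge0_integral_mscale// integral_dirac// diracT mul1e.
- move=> A mA; rewrite /k/= /mscale/= /dirac/=.
  apply: emeasurable_funM; first exact/measurable_EFinP.
  by apply/measurable_EFinP; exact: measurable_indic.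
- move=> A mA; rewrite nuE// integral_mkcond; apply: eq_integral => x _.
  rewrite patchE /k/= /mscale/= /dirac indicE.
  by case: (x \in A); rewrite ?mule1 ?mule0.
Qed.

(** * Exponential times *)

Section exponential_time.
Context {R : realType} (a : R).

Definition exp_law (a0 : 0 < a) : probability (measurableTypeR R) R.
Proof. by unshelve refine (exponential_prob a : probability _ _). Defined.

Lemma integral_exp_law (a0 : 0 < a) (g : R -> \bar R) :
  measurable_fun setT g -> (forall t, 0 <= g t)%E ->
  (\int[exp_law a0]_t g t = a%:E *
   \int[lebesgue_measure]_(t in `[0%R, +oo[) ((expR (- (a * t)))%:E * g t))%E.
Proof.
move=> mg g0.
have mpdf := measurable_exponential_pdf a.
rewrite (@integral_density _ _ _ lebesgue_measure _ (exponential_pdf a))//; last first.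
  by move=> t; exact: (exponential_pdf_ge0 (ltW a0)).
have mexp : measurable_fun setT (fun t : R => ((expR (- (a * t)))%:E * g t)%E).
  apply: emeasurable_funM => //; apply/measurable_EFinP.
  by apply: measurableT_comp => //; exact: measurableT_comp.
rewrite -ge0_integralZl//; first last.
- by rewrite lee_fin ltW.
- by move=> t _; rewrite mule_ge0// lee_fin expR_ge0.
- exact: measurable_funTS.
rewrite [RHS]integral_mkcond; apply: eq_integral => t _; rewrite /exponential_pdf !patchE.
by case: ifPn => _; rewrite ?mul0e// EFinM muleA mulNr.
Qed.

Lemma integral_exp_law_cst (a0 : 0 < a) (c : \bar R) :
  (\int[exp_law a0]_t cst c t = c)%E.
Proof.
rewrite integral_cst// -[RHS]mule1; congr (_ * _)%E; exact: probability_setT.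
Qed.

End exponential_time.

(** The product of the two exponentials is the one of rate [a + s], and the exponential law of that
    rate has mass one. *)
Lemma exp_law_tail {R : realType} (a : R) (a0 : 0 < a) (s : R) : 0 <= s ->
  (\int[exp_law a0]_t (expR (- (s * t)))%:E = (a / (a + s))%:E)%E.
Proof.
move=> s0; have as0 : 0 < a + s by rewrite ltr_pwDl.
rewrite integral_exp_law; last 2 first.
- apply/measurable_EFinP; apply: measurableT_comp => //.
  exact: measurableT_comp.
- by move=> t; rewrite lee_fin expR_ge0.
have := integral_exp_law as0 (measurable_cst 1%E) (fun=> lee01).
rewrite integral_exp_law_cst.
under eq_integral do rewrite mule1.
under [in X in _ -> X]eq_integral do rewrite -EFinM -expRD -opprD -mulrDl.
set J := (\int[_]_(t in _) _)%E => J1.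
have -> : J = ((a + s)^-1)%:E.
  by rewrite -[RHS]mule1 J1 muleA -EFinM mulVf ?gt_eqF// mul1e.
by rewrite -EFinM.

Qed.

Section resolvent_kernel.
Context {R : realType} {d d' : measure_display}.
Context {E : measurableType d} {Om : measurableType d'}.
Variables (O : set (set E)) (Z : process R E Om).
Variables (lusO : lusin_topology R O) (rZ : right_process O Z).

(** The Lusin hypothesis is an argument because the measurability that makes this a kernel rests on
    it. *)
Definition position_kernel of lusin_topology R O :
    (E * measurableTypeR R)%type -> {measure set E -> \bar R} :=
  position_measure (right_markov rZ).

HB.instance Definition _ := isKernel.Build _ _ _ _ R (position_kernel lusO)
  (measurable_position lusO rZ).

Let position_kernel_le1 :
  (ereal_sup [set position_kernel lusO xt setT | xt in setT] <= 1)%E.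
Proof.
apply: ge_ereal_sup => _ [xt _ <-]; apply: probability_le1.
by apply: (visits_measurable (right_markov rZ)) => //; rewrite ?le_max ?lexx.
Qed.

HB.instance Definition _ := Kernel_isSubProbability.Build _ _ _ _ R
  (position_kernel lusO) position_kernel_le1.

Variables (a : R) (a0 : 0 < a).

Definition exp_kernel : E -> {measure set (measurableTypeR R) -> \bar R} :=
  kprobability (measurable_cst (exp_law a0 : pprobability (measurableTypeR R) R)
    : measurable_fun [set: E] (cst _)).

HB.instance Definition _ := ProbabilityKernel.on exp_kernel.

(** The law of the position at an exponential time independent of the path, that is [a U_a];
    independence is encoded by [exp_kernel] being constant in the starting point. *)
Definition resolvent_kernel : E -> {measure set E -> \bar R} :=
  (exp_kernel \; position_kernel lusO)%E.

Lemma measurable_position_integral (f : E -> \bar R) :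
  measurable_fun setT f -> (forall y, 0 <= f y)%E ->
  measurable_fun [set: E * R]
    (fun xt => \int[position_measure (right_markov rZ) xt]_y f y)%E.
Proof.
move=> mf f0; apply: measurable_fun_integral_kernel => // B mB.
exact: measurable_position.
Qed.

Lemma measurable_position_time (f : E -> \bar R) x :
  measurable_fun setT f -> (forall y, 0 <= f y)%E ->
  measurable_fun [set: R]
    (fun t => \int[position_measure (right_markov rZ) (x, t)]_y f y)%E.
Proof.
move=> mf f0.
exact: (measurableT_comp (measurable_position_integral mf f0) (measurable_pair1 x)).
Qed.

Lemma integral_resolvent_exp (f : E -> \bar R) x :
  measurable_fun setT f -> (forall y, 0 <= f y)%E ->
  (\int[resolvent_kernel x]_y f y = \int[exp_law a0]_t
     \int[position_measure (right_markov rZ) (x, t)]_y f y)%E.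
Proof. by move=> mf f0; exact: integral_kcomp. Qed.

Lemma integral_resolvent (f : E -> \bar R) x :
  measurable_fun setT f -> (forall y, 0 <= f y)%E ->
  (\int[resolvent_kernel x]_y f y = a%:E * resolvent Z a f x)%E.
Proof.
move=> mf f0; rewrite integral_resolvent_exp// integral_exp_law.
- congr (_ * _)%E; apply: eq_integral => t; rewrite inE/= in_itv/= andbT => t0.
  by rewrite (transitionE lusO rZ).
- exact: measurable_position_time.
- by move=> t; exact: integral_ge0.
Qed.

Lemma resolvent_submarkov_kernel : submarkov_kernel resolvent_kernel.
Proof.
split; first by move=> A mA; exact: measurable_kernel.
move=> x; rewrite /resolvent_kernel/= /kcomp.
have -> : 1%E = (\int[exp_kernel x]_t (cst 1%E t))%E.
  by rewrite integral_cst// mul1e; apply/esym; exact: prob_kernel.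
apply: ge0_le_integral => //.
- by have := measurable_kernel (position_kernel lusO) setT measurableT => H;
    exact: (measurableT_comp H (measurable_pair1 x)).
- by move=> t _; exact: sprob_kernel_le1.
Qed.

(** The Markov property on the whole of [Om], extended from sets to functions by [integral_bind]. *)
Lemma chapman_kolmogorov (f : E -> \bar R) x (s t : R) : 0 <= s -> 0 <= t ->
  measurable_fun setT f -> (forall y, 0 <= f y)%E ->
  (\int[position_measure (right_markov rZ) (x, (s + t)%R)]_y f y =
   \int[position_measure (right_markov rZ) (x, s)]_y
     \int[position_measure (right_markov rZ) (y, t)]_z f z)%E.
Proof.
move=> s0 t0 mf f0; pose mZ := right_markov rZ.
have mk A : measurable A -> measurable_fun setT (fun y => position_measure mZ (y, t) A).
  move=> mA; rewrite /position_measure/= /position/=.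
  by apply: (law_borel mZ); rewrite // le_max lexx.
apply: (integral_bind (k := fun y => position_measure mZ (y, t))) => // A mA.
rewrite integral_position//; last exact: mk.
have [[fT fC _] _] := filt_sigma_algebra mZ s0.
have F : filt Z s setT by rewrite -(setC0) -setTD; exact: fC.
have := markov_property mZ x s0 t0 F mA; rewrite setTI.
by rewrite /position_measure/= /position/= !max_r ?addr_ge0// => ->.
Qed.

End resolvent_kernel.

Lemma integral_lebesgue_shift {R : realType} (s : R) (g : R -> \bar R) :
  measurable_fun setT g -> (forall t, 0 <= g t)%E ->
  (\int[lebesgue_measure]_(t in `[0%R, +oo[) g (s + t)%R =
   \int[lebesgue_measure]_(t in `[s, +oo[) g t)%E.
Proof.
move=> mg g0; pose shift : measurableTypeR R -> measurableTypeR R := fun t => s + t.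
have mshift : measurable_fun setT shift by exact: measurable_funD.
have shift_leb A : measurable A -> pushforward lebesgue_measure shift A = lebesgue_measure A.
  move=> mA; apply/esym/lebesgue_measure_unique => //= _ [[b c]] _ <-.
  rewrite /pushforward (_ : shift @^-1` _ = `](b - s), (c - s)]%classic).
    by rewrite !lebesgue_measure_itv/= !lte_fin ltrD2r; case: ifP => // _;
      rewrite -!EFinB; congr EFin; ring.
  by apply/seteqP; split => t /=; rewrite !in_itv/= /shift ltrBlDl lerBrDl.
rewrite (_ : `[0%R, +oo[%classic = shift @^-1` `[s, +oo[%classic); last first.
  by apply/seteqP; split => t /=; rewrite !in_itv/= !andbT /shift lerDl.
rewrite -(@ge0_integral_pushforward _ _ _ _ _ shift mshift)//=; last exact: measurable_funTS.
by apply: eq_measure_integral => A mA _; exact: shift_leb.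
Qed.

Lemma finite_tonelli {R : realType} {d d'} {X : measurableType d}
    {Y : measurableType d'} (m1 : {measure set X -> \bar R})
    (m2 : {finite_measure set Y -> \bar R}) (g : X * Y -> \bar R) :
  (m1 setT < +oo)%E -> measurable_fun setT g -> (forall z, 0 <= g z)%E ->
  (\int[m1]_x \int[m2]_y g (x, y) = \int[m2]_y \int[m1]_x g (x, y))%E.
Proof.
move=> m1oo mg g0.
pose m1' : {finite_measure set X -> \bar R} := mfrestr measurableT m1oo.
have m1E (k : X -> \bar R) : (\int[m1]_x k x = \int[m1']_x k x)%E.
  by apply: eq_measure_integral => A mA _; rewrite /m1'/= /mfrestr/= /mrestr setIT.
rewrite m1E; under [in RHS]eq_integral do rewrite m1E.
exact: (fubini_tonelli (m1 := m1') (m2 := m2)).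
Qed.

(** * Excessivity of [a U_a f] for [0 <= f <= 1] *)

Section resolvent_excessive.
Context {R : realType} {d d' : measure_display}.
Context {E : measurableType d} {Om : measurableType d'}.
Variables (O : set (set E)) (Z : process R E Om).
Variables (lusO : lusin_topology R O) (rZ : right_process O Z).
Variables (a : R) (a0 : 0 < a) (f : E -> \bar R).
Hypotheses (mf : measurable_fun setT f) (f0 : forall y, (0 <= f y)%E).
Hypothesis f1 : forall y, (f y <= 1)%E.

Let mZ := right_markov rZ.
Let p x t := (\int[position_measure mZ (x, t)]_y f y)%E.
Let h x := (\int[resolvent_kernel lusO rZ a0 x]_y f y)%E.

Let p0 x t : (0 <= p x t)%E. Proof. exact: integral_ge0. Qed.

Let mp x : measurable_fun setT (p x).
Proof. exact: measurable_position_time. Qed.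

Let h0 x : (0 <= h x)%E. Proof. exact: integral_ge0. Qed.

Let mh : measurable_fun setT h.
Proof.
by apply: measurable_kernel_integral => //; exact: resolvent_submarkov_kernel.
Qed.

Let h1 x : (h x <= 1)%E.
Proof.
have sT := resolvent_submarkov_kernel lusO rZ a0.
apply: (@le_trans _ _ (\int[resolvent_kernel lusO rZ a0 x]_y (cst 1%E y))%E).
  exact: ge0_le_integral.
by rewrite integral_cst// mul1e; exact: sT.2.
Qed.

Let p1 x t : (p x t <= 1)%E.
Proof.
apply: (@le_trans _ _ (\int[position_measure mZ (x, t)]_y (cst 1%E y))%E).
  exact: ge0_le_integral.
rewrite integral_cst// mul1e; apply: probability_le1.
by apply: (visits_measurable mZ) => //; rewrite le_max lexx.
Qed.

Let q x t := ((a * expR (- (a * t)))%:E * p x t)%E.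

Let mexp (c : R) : measurable_fun setT (fun t : R => expR (- (c * t))).
Proof. by apply: measurableT_comp => //; exact: measurableT_comp. Qed.

Let mep (g : R -> \bar R) c : measurable_fun setT g ->
  measurable_fun setT (fun t : R => ((expR (- (c * t)))%:E * g t)%E).
Proof.
move=> mg; apply: emeasurable_funM => //.
by apply/measurable_EFinP; exact: mexp.
Qed.

Let mq x : measurable_fun setT (q x).
Proof.
apply: emeasurable_funM => //; apply/measurable_EFinP.
by apply: measurable_funM => //; exact: mexp.
Qed.

Let q0 x t : (0 <= q x t)%E.
Proof. by rewrite mule_ge0// lee_fin mulr_ge0 ?expR_ge0// ltW. Qed.

Let hE x : h x = (\int[lebesgue_measure]_(t in `[0%R, +oo[) q x t)%E.
Proof.
rewrite /h integral_resolvent_exp// integral_exp_law//.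
rewrite -ge0_integralZl//; first last.
- by rewrite lee_fin ltW.
- by move=> t _; apply: mule_ge0; [rewrite lee_fin expR_ge0|exact: p0].
- by apply: measurable_funTS; apply: mep; exact: mp.
- by apply: eq_integral => t _; rewrite muleA -EFinM.
- exact: mp.
- by move=> t; exact: p0.
Qed.

(** By Tonelli and Chapman-Kolmogorov, [P_s h] averages [p x (s + t)] over an exponential [t];
    discounting by [exp(-a s)] and translating time leave the tail from [s] of the integral defining
    [h]. *)
Let shift_h x s : 0 <= s ->
  ((expR (- (a * s)))%:E * \int[position_measure mZ (x, s)]_y h y =
   \int[lebesgue_measure]_(t in `[s, +oo[) q x t)%E.
Proof.
move=> s0; rewrite -integral_lebesgue_shift//.
have mps : measurable_fun setT (fun t => p x (s + t)).
  by apply: (measurableT_comp (mp x)); exact: measurable_funD.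
(* Position measures read negative times as 0, hence the clipping, which the exponential law does
   not see. *)
have ck t : (\int[position_measure mZ (x, s)]_y p y t = p x (s + Num.max 0 t)%R)%E.
  have t0 : 0 <= Num.max 0 t by rewrite le_max lexx.
  apply: etrans (esym (chapman_kolmogorov rZ x s0 t0 mf f0)).
  by apply: eq_integral => y _; exact: integral_position_max.
have -> : (\int[position_measure mZ (x, s)]_y h y =
    \int[exp_law a0]_t p x (s + t)%R)%E.
  transitivity (\int[position_measure mZ (x, s)]_y \int[exp_law a0]_t p y t)%E.
    by apply: eq_integral => y _; rewrite /h integral_resolvent_exp.
  transitivity (\int[exp_law a0]_t \int[position_measure mZ (x, s)]_y p y t)%E.
    apply: (@finite_tonelli _ _ _ _ _ _ (exp_law a0) (fun yt => p yt.1 yt.2)).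
    - apply: le_lt_trans (probability_le1 (law Z x) _) (ltry 1).
      by apply: (visits_measurable mZ) => //; rewrite le_max lexx.
    - apply: eq_measurable_fun (measurable_position_integral lusO rZ mf f0).
      by move=> [y t] _.
    - by move=> yt; exact: p0.
  under eq_integral do rewrite ck.
  rewrite [LHS]integral_exp_law; last 2 first.
  - apply: (measurableT_comp (mp x)); apply: measurable_funD => //.
    exact: measurable_maxr.
  - by move=> t; exact: p0.
  rewrite [RHS]integral_exp_law; [|exact: mps|by move=> t; exact: p0].
  apply: (congr1 (fun I => a%:E * I)%E); apply: eq_integral => t.
  by rewrite inE/= in_itv/= andbT => t0; rewrite max_r.
rewrite integral_exp_law; [|exact: mps|by move=> t; exact: p0].
rewrite -ge0_integralZl//; first last.
- by rewrite lee_fin ltW.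
- by move=> t _; apply: mule_ge0; [rewrite lee_fin expR_ge0|exact: p0].
- by apply: measurable_funTS; exact: mep.
rewrite -ge0_integralZl//; first last.
- move=> t _; apply: mule_ge0; first by rewrite lee_fin ltW.
  by apply: mule_ge0; [rewrite lee_fin expR_ge0|exact: p0].
- by apply: measurable_funeM; apply: measurable_funTS; exact: mep.
apply: eq_integral => t _; rewrite /q mulrDr opprD expRD.
rewrite !muleA -!EFinM; congr (_%:E * _)%E; ring.
Qed.

Let J x s := ((expR (- (a * Num.max 0 s)))%:E *
  \int[position_measure mZ (x, Num.max 0 s)%R]_y h y)%E.

Let max_ge0 (s : R) : 0 <= Num.max 0 s. Proof. by rewrite le_max lexx. Qed.

Let mmax : measurable_fun setT (fun s : R => Num.max 0 s).
Proof. exact: measurable_maxr. Qed.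

Let J0 x s : (0 <= J x s)%E.
Proof. by apply: mule_ge0; [rewrite lee_fin expR_ge0|exact: integral_ge0]. Qed.

Let mJ x : measurable_fun setT (J x).
Proof.
have mH := measurable_position_time lusO rZ x mh h0.
exact: (measurableT_comp (mep a mH) mmax).
Qed.

Let J_le x s : (J x s <= h x)%E.
Proof.
rewrite /J shift_h// hE; apply: ge0_subset_integral => //.
  exact: (measurable_funTS (mq x)).
by move=> t /=; rewrite !in_itv/= !andbT; exact: le_trans.
Qed.

(** The missing part [h - J] is the integral of [q] over [[0, s[], at most [1 - exp(-a s)] because
    [f <= 1]. Written as a sum, the inequality avoids extended subtraction. *)
Let J_ge x s : (h x + (expR (- (a * Num.max 0 s)))%:E <= J x s + 1)%E.
Proof.
rewrite /J shift_h//; move: (Num.max 0 s) (max_ge0 s) => {s} s.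
rewrite le_eqVlt => /predU1P[<-|s0]; first by rewrite -hE mulr0 oppr0 expR0.
rewrite hE (@itv_bndbnd_setU _ _ _ (BLeft s))//; last by rewrite bnd_simp ltW.
rewrite ge0_integral_setU//; last 2 first.
- exact: (measurable_funTS (mq x)).
- apply/disj_set2P; apply/seteqP; split => // t [/=]; rewrite !in_itv/= andbT.
  by move=> /andP[_ ts]; rewrite leNgt ts.
have q_pdf : (\int[lebesgue_measure]_(t in `[0%R, s[) q x t <=
    (1 - expR (- (a * s)))%:E)%E.
  rewrite EFinB -mulNr -exponential_prob_itv0c//.
  apply: (@le_trans _ _
      (\int[lebesgue_measure]_(t in `[0%R, s[) (exponential_pdf a t)%:E)%E).
    apply: ge0_le_integral => //.
    - exact: (measurable_funTS (mq x)).
    - apply: measurable_funTS; apply/measurable_EFinP.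
      exact: measurable_exponential_pdf.
    - move=> t /=; rewrite in_itv/= => /andP[t0 _].
      rewrite exponential_pdfE// mulNr /q -[leRHS]mule1.
      by apply: lee_wpmul2l (p1 x t); rewrite lee_fin mulr_ge0 ?expR_ge0// ltW.
  apply: ge0_subset_integral => //.
  - apply: measurable_funTS; apply/measurable_EFinP.
    exact: measurable_exponential_pdf.
  - by move=> t _; rewrite lee_fin (exponential_pdf_ge0 (ltW a0)).
  - by move=> t /=; rewrite !in_itv/= => /andP[-> /ltW].
rewrite [X in (X + _ <= _)%E]addeC -addeA leeD2l//.
by apply: le_trans (leeD2r _ q_pdf) _; rewrite -EFinD subrK.
Qed.

(** Discounting at rate [a + b] splits into the factor [exp(-a s)] kept in [J] and the density of
    rate [b]. *)
Let resolventJ (b : R) (b0 : 0 < b) x :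
  (b%:E * resolvent Z (a + b) h x = \int[exp_law b0]_s J x s)%E.
Proof.
rewrite integral_exp_law//; apply: (congr1 (fun I => b%:E * I)%E).
apply: eq_integral => s; rewrite inE/= in_itv/= andbT => s0.
rewrite /J max_r// (transitionE lusO rZ)// muleA -EFinM -expRD.
by rewrite mulrDl opprD addrC.
Qed.

(** Averaging [J <= h] over an exponential time of rate [b] gives the upper bound. Averaging [J_ge]
    shows that the defect is at most [1 - b / (b + a) <= a / b], which tends to 0. *)
Lemma resolvent_kernel_excessive : excessive (resolvent Z) a h.
Proof.
have upper (b : R) x : 0 < b -> (b%:E * resolvent Z (a + b) h x <= h x)%E.
  move=> b0; rewrite (resolventJ b0).
  apply: (@le_trans _ _ (\int[exp_law b0]_s cst (h x) s)%E).
    by apply: ge0_le_integral => //; exact: mJ.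
  by rewrite integral_exp_law_cst.
have hfin x : h x \is a fin_num.
  by rewrite ge0_fin_numE// (le_lt_trans (h1 x) (ltry 1)).
split => // x.
have [r hr] : exists r, h x = r%:E by exists (fine (h x)); rewrite fineK.
have r0 : (0 <= r%:E)%E by rewrite -hr.
have mE : measurable_fun setT (fun s : R => (expR (- (a * Num.max 0 s)))%:E).
  by apply/measurable_EFinP; exact: (measurableT_comp (mexp a) mmax).
have E0 (s : R) : (0 <= (expR (- (a * Num.max 0 s)))%:E)%E.
  by rewrite lee_fin expR_ge0.
have lower (b : R) : 0 < b -> (r%:E - (a / b)%:E <= b%:E * resolvent Z (a + b) h x)%E.
  move=> b0; rewrite (resolventJ b0).
  have L : (\int[exp_law b0]_s (r%:E + (expR (- (a * Num.max 0 s)))%:E) =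
      (r + b / (b + a))%:E)%E.
    rewrite ge0_integralD// [X in (X + _)%E](integral_exp_law_cst b0 r%:E) EFinD.
    apply: (congr1 (fun I => r%:E + I)%E).
    rewrite -(exp_law_tail b0 (ltW a0)) [LHS]integral_exp_law// [RHS]integral_exp_law.
    - apply: (congr1 (fun I => b%:E * I)%E).
      by apply: eq_integral => s; rewrite inE/= in_itv/= andbT => s0; rewrite max_r.
    - by apply/measurable_EFinP; exact: mexp.
    - by move=> s; rewrite lee_fin expR_ge0.
  have Rr : (\int[exp_law b0]_s (J x s + 1) = \int[exp_law b0]_s J x s + 1)%E.
    rewrite ge0_integralD//; last exact: mJ.
    by rewrite [X in (_ + X)%E](integral_exp_law_cst b0 1%E).
  have : ((r + b / (b + a))%:E <= \int[exp_law b0]_s J x s + 1)%E.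
    rewrite -L -Rr; apply: ge0_le_integral => //.
    - by move=> s _; rewrite adde_ge0.
    - exact: emeasurable_funD.
    - by apply: emeasurable_funD => //; exact: mJ.
    - by move=> s _; rewrite -hr; exact: J_ge.
  have ab : 1 - a / b <= b / (b + a).
    rewrite -subr_ge0 (_ : _ - _ = a ^+ 2 / (b * (b + a))); last first.
      by field; rewrite !gt_eqF// addr_gt0.
    by rewrite divr_ge0 ?sqr_ge0// mulr_ge0 ?addr_ge0 ?ltW.
  move: (\int[exp_law b0]_s J x s)%E => [i| |]; rewrite ?leey// -?EFinD ?lee_fin//.
  by move=> hi; lra.
rewrite hr.
apply: (@squeeze_cvge _ _ _ _ (fun b : R => r%:E - (a / b)%:E)%E _ (cst r%:E)).
- near=> b; rewrite lower ?(le_trans (upper _ _ _)) ?hr//.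
- rewrite -[X in _ --> X]sube0; apply: cvgeB => //; first exact: cvg_cst.
  apply: cvg_EFin; first exact: nearW.
  rewrite -(mulr0 a); apply: cvgM; first exact: cvg_cst.
  by apply/gtr0_cvgV0; [near=> b|exact: cvg_id].
- exact: cvg_cst.
Unshelve. all: by end_near. Qed.

End resolvent_excessive.

(** * Martingales and stationary functions *)

(** If no such time existed, the interval []b, c]] inside []s, s'[] would be null and the
    distribution function [1 - exp(-a t)] would agree at [b] and [c]. *)
Lemma exp_law_charges_itv {R : realType} (a : R) (a0 : 0 < a) (P : R -> Prop) (s s' : R) :
  {ae exp_law a0, forall t, P t} -> 0 <= s -> s < s' ->
  exists t, [/\ s < t, t < s' & P t].
Proof.
move=> [N [mN N0 PN]] s0 ss'; apply: contrapT => H.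
pose b := (s + s') / 2; pose c := (b + s') / 2.
have sb : s < b by rewrite /b; lra.
have bc : b < c by rewrite /c /b; lra.
have cs' : c < s' by rewrite /c /b; lra.
have b0 : 0 < b by exact: le_lt_trans sb.
have sub : `]b, c]%classic `<=` N.
  move=> t /=; rewrite in_itv/= => /andP[bt tc]; apply: PN => /= Pt; apply: H.
  by exists t; split => //; [exact: lt_trans bt|exact: le_lt_trans cs'].
have bc0 : exp_law a0 `]b, c]%classic = 0%E.
  exact: (@subset_measure0 _ _ _ (exp_law a0) _ N).
have : exp_law a0 `[0, c]%classic = exp_law a0 `[0, b]%classic.
  rewrite (@itv_bndbnd_setU _ _ _ (BRight b)) ?bnd_simp//; last 2 first.
  - exact: ltW.
  - exact: ltW.
  rewrite measureU//= ?[X in (_ + X)%E]bc0 ?adde0//.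
  by apply/seteqP; split => // t [/=]; rewrite !in_itv/= => /andP[_ tb] /andP[]; rewrite ltNge tb.
rewrite /exp_law/= !exponential_prob_itv0c//; last exact: lt_trans bc.
move=> [] /(addrI 1) /oppr_inj /expR_inj; rewrite !mulNr => /oppr_inj.
have an0 : a != 0 by rewrite gt_eqF.
by move=> /(mulfI an0) cb; move: bc; rewrite cb ltxx.
Qed.

Section constant_paths.
Context {R : realType} {d d' : measure_display}.
Context {E : measurableType d} {Om : measurableType d'}.
Variables (O : set (set E)) (Z : process R E Om).
Variables (lusO : lusin_topology R O) (rZ : right_process O Z).
Variables (a : R) (a0 : 0 < a) (m : {measure set E -> \bar R}).
Let mZ := right_markov rZ.
Let T := resolvent_kernel lusO rZ a0.
Hypothesis mT : subinvariant m T.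
Let sT : submarkov_kernel T := resolvent_submarkov_kernel lusO rZ a0.

(** [T x] averages the one-time laws: a null average of nonnegative terms, or an average one of
    terms at most one, decides almost every [t]. Death is harmless when [c = 0], the value at the
    cemetery. *)
Lemma along_ae_constant (h : E -> \bar R) x (c : \bar R) :
  measurable_fun setT h -> T x [set y | h y != c] = 0%E ->
  (c != 0%E -> T x setT = 1%E) ->
  {ae exp_law a0, forall t, 0 <= t ->
    {ae law Z x, forall w, along Z h t w = c}}.
Proof.
move=> mh hc c1.
have mN : measurable [set y | h y != c].
  rewrite (_ : mkset _ = ~` (h @^-1` [set c])); last first.
    by apply/seteqP; split => y /= /eqP.
  by apply: measurableC; rewrite -[X in measurable X]setTI; exact: mh.
have mt A : measurable A ->
    measurable_fun setT (fun t : R => position_measure mZ (x, t) A).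
  move=> mA; have H := measurable_position lusO rZ mA.
  exact: (measurableT_comp H (measurable_pair1 x)).
have null : {ae exp_law a0, forall t, position_measure mZ (x, t) [set y | h y != c] = 0%E}.
  have := (ae_eq_integral_abs (exp_law a0) measurableT (mt _ mN)).1.
  under eq_integral do rewrite gee0_abs//.
  by move=> /(_ hc); apply: filterS => t; apply.
have full : {ae exp_law a0, forall t, c != 0%E -> position_measure mZ (x, t) setT = 1%E}.
  have [c0|/c1 Tx1] := eqVneq c 0%E; first exact: aeW.
  have H : {ae exp_law a0, forall t, cst 1%E t = position_measure mZ (x, t) setT}.
    apply: ae_le_integral_eq => //.
    - exact: mt.
    - apply: aeW => t; apply: probability_le1.
      by apply: (visits_measurable mZ) => //; rewrite le_max lexx.
    - by rewrite integral_exp_law_cst -[leLHS]Tx1.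
    - by apply: (@le_lt_trans _ _ 1%E); rewrite ?ltry// -[leRHS]Tx1.
  move: H; apply: (@filterS _ _ (ae_filter_ringOfSetsType (exp_law a0))) => t <- //.
move: null full.
apply: (@filterS2 _ _ (ae_filter_ringOfSetsType (exp_law a0))) => t nt ft t0.
have vN : {ae law Z x, forall w, ~ visits Z t [set y | h y != c] w}.
  exists (visits Z t [set y | h y != c]); split.
  - exact: (visits_measurable mZ).
  - by move: nt; rewrite /position_measure/= /position/= max_r.
  - by move=> w /= /contrapT.
have vT : {ae law Z x, forall w, c != 0%E -> visits Z t setT w}.
  have [c0|cn0] := eqVneq c 0%E; first exact: aeW.
  have mv : measurable (visits Z t setT) by exact: (visits_measurable mZ).
  exists (~` visits Z t setT); split; first exact: measurableC.
    rewrite probability_setC//; have := ft cn0.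
    by rewrite /position_measure/= /position/= max_r// => ->; rewrite subee.
  by move=> w /= /not_implyP[_].
apply: filterS2 vN vT => w; case yE : (state Z t w) => [y|] vn vt.
  rewrite (along_Some _ yE); apply: contrapT => /eqP hy.
  by apply: vn; exists y.
rewrite (along_None _ yE); have [//|/vt] := eqVneq c 0%E.
by move=> /(visits_None yE).
Qed.

(** The image [h = T f] equals [f] almost everywhere, also under [T x] for almost every [x], so it
    takes the same constant value; unlike [f], it is known to be right continuous along the
    paths. *)
Lemma stationary_along (f : E -> R) : measurable_fun setT f ->
  (forall y, 0 <= f y <= 1) -> stationary m T f ->
  {ae m, forall x, {ae law Z x, forall w, forall t, 0 <= t ->
    along Z (fun y => \int[T y]_z (f z)%:E)%E t w = (f x)%:E}}.
Proof.
move=> mf f01 sf.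
pose h y := (\int[T y]_z (f z)%:E)%E.
have mfE : measurable_fun setT (EFin \o f) by exact/measurable_EFinP.
have f0 y : (0 <= (EFin \o f) y)%E by rewrite lee_fin; case/andP : (f01 y).
have f1 y : ((EFin \o f) y <= 1)%E by rewrite lee_fin; case/andP : (f01 y).
have mh : measurable_fun setT h by exact: measurable_kernel_integral.
have exh : excessive (resolvent Z) a h by exact: resolvent_kernel_excessive.
have hf := stationary_fixed _ _ _ mf sf.
have hf2 := subinvariant_ae _ _ _ sT mT hf.
move: sf; rewrite /stationary; apply: filterS2 hf2 => x hfx [Tx0 Tx1].
have Th : T x [set y | h y != (f x)%:E] = 0%E.
  have mN2 : measurable [set y | h y != (f x)%:E].
    rewrite (_ : mkset _ = ~` (h @^-1` [set (f x)%:E])); last first.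
      by apply/seteqP; split => y /= /eqP.
    by apply: measurableC; rewrite -[X in measurable X]setTI; exact: mh.
  apply/negligibleP => //.
  have Tne : {ae T x, forall y, f y = f x}.
    exists [set y | f y != f x]; split => //; first exact: measurable_neq_cst.
    by move=> y /= /eqP.
  have : {ae T x, forall y, h y = (f x)%:E}.
    by apply: filterS2 hfx Tne => y hy fy; rewrite /h hy fy.
  by apply: negligibleS => y /= /eqP.
have good := along_ae_constant mh Th.
have {}good : {ae exp_law a0, forall t, 0 <= t ->
    {ae law Z x, forall w, along Z h t w = (f x)%:E}}.
  by apply: good; rewrite eqe => /Tx1.
(* The exceptional paths depend on [t]. One good time for each pair of rationals leaves a single
   null set, off which good times are dense. *)
have dense : {ae law Z x, forall w, forall q q' : rat, 0 < q -> q < q' ->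
    exists t, [/\ ratr q < t, t < ratr q' & along Z h t w = (f x)%:E]}.
  apply: ae_rat => q; apply: ae_rat => q'.
  have [q0|q0] := ltP 0 q; last exact: aeW.
  have [qq'|qq'] := ltP q q'; last exact: aeW.
  have qR : 0 <= ratr q :> R by rewrite ler0q ltW.
  have [|t [qt tq' gt]] := exp_law_charges_itv good qR (_ : _ < ratr q').
    by rewrite ltr_rat.
  have := gt (ltW (le_lt_trans qR qt)); apply: filterS => w hw _ _.
  by exists t.
apply: filterS2 dense (excessive_right_continuous rZ x a0 exh) => w dw rc t t0.
(* Otherwise right continuity would keep [h] off the value [f x] on some []t, t + e[], while a good
   time lies between two rationals of that interval. *)
apply: contrapT => neq.
have : \forall s \near t^'+, (~` [set (f x)%:E]) (along Z h s w).
  have /(_ (~` [set (f x)%:E])) := rc t t0; apply.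
  apply: open_nbhs_nbhs; split => //.
  by apply: closed_openC; apply: accessible_closed_set1; apply: hausdorff_accessible; exact: ereal_hausdorff.
rewrite /at_right near_withinE => /nbhs_ballP[e /= e0 be].
have [|q /andP[tq qe]] := @rat_in_itvoo _ t (t + e); first by rewrite ltrDl.
have [|q' /andP[qq' qe']] := @rat_in_itvoo _ (ratr q) (t + e); first exact: qe.
have q0 : 0 < q by rewrite -(ltr0q R); exact: le_lt_trans tq.
have qq'' : q < q' by rewrite -(ltr_rat R).
have [s [qs sq' hs]] := dw q q' q0 qq''.
have ts : t < s by exact: lt_trans qs.
apply: (be s _ ts hs).
rewrite /ball/= ltr0_norm ?subr_lt0// opprB ltrBlDl.
exact: lt_trans sq' qe'.
Qed.

Lemma constant_martingale (v : E -> R) x (c : R) : measurable_fun setT v ->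
  {ae law Z x, forall w, forall t, 0 <= t -> along Z v t w = c} ->
  martingale (law Z x) (filt Z) (along Z v).
Proof.
move=> mv vc.
have ma t : 0 <= t -> measurable_fun setT (EFin \o along Z v t).
  by move=> t0; apply/measurable_EFinP; exact: measurable_along.
have Ec A t : 0 <= t -> measurable A ->
    (\int[law Z x]_(w in A) (along Z v t w)%:E = \int[law Z x]_(w in A) cst c%:E w)%E.
  move=> t0 mA; apply: ae_eq_integral => //.
  - exact: (measurable_funTS (ma t t0)).
  - by apply: filterS vc => w /(_ t t0) -> _.
split.
- move=> t S t0 mS; apply: along_adapted => //.
  by rewrite -[X in measurable X]setTI; exact: mv.
- move=> t t0; apply/integrableP; split; first exact: ma.
  rewrite (ae_eq_integral (cst `|c|%:E))//; first last.
  - by apply: filterS vc => w /(_ t t0) /= -> _.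
  - by apply: measurableT_comp => //; exact: ma.
  rewrite integral_cst// lte_mul_pinfty//.
  exact: le_lt_trans (probability_le1 (law Z x) measurableT) (ltry 1).
- move=> s t A s0 st As; have [_ /(_ _ As) mA] := filt_sigma_algebra mZ s0.
  by rewrite !Ec// (le_trans s0).
Qed.

(* The excessive functions used must be finite; squash makes u^+ and u^- bounded
   and unsquash recovers them. *)
Definition squash (s : R) : R := 1 - expR (- Num.max 0 s).

Definition unsquash (s : R) : R := - ln (1 - s).

Lemma squash01 s : 0 <= squash s <= 1.
Proof. by rewrite subr_ge0 gerBl expR_ge0 expR_le1 oppr_le0 le_max lexx. Qed.

Lemma squashK s : unsquash (squash s) = Num.max 0 s.
Proof. by rewrite /unsquash /squash subKr expRK opprK. Qed.

Lemma measurable_squash : measurable_fun setT squash.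
Proof.
apply: measurable_funB => //; apply: measurableT_comp => //.
by apply: measurableT_comp => //; exact: measurable_maxr.
Qed.

Lemma measurable_unsquash : measurable_fun setT unsquash.
Proof.
have mB : measurable_fun setT (fun s : R => 1 - s) by exact: measurable_funB.
have ml : measurable_fun setT (fun s : R => ln (1 - s)).
  by apply: (@measurableT_comp _ _ _ _ _ _ (@ln R)).
exact: measurableT_comp ml.
Qed.

(** The representative [v] undoes the squashing of the kernel images of both parts of [u]. Along
    almost every path started at almost every [x] these images are constant, so [v] keeps the value
    [u x]. *)
Lemma stationary_ae_martingale (u : E -> R) : measurable_fun setT u ->
  stationary m T u -> ae_martingale m id Z u.
Proof.
move=> mu su.
have mNu : measurable_fun setT (fun x => - u x) by exact: measurableT_comp.
have squash0 : squash 0 = 0 by rewrite /squash maxxx oppr0 expR0 subrr.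
have sp : stationary m T (squash \o u).
  by apply: stationary_comp => //; exact: measurable_squash.
have sn : stationary m T ((squash \o -%R) \o u).
  apply: stationary_comp => //=; last by rewrite oppr0.
  by apply: measurableT_comp => //; exact: measurable_squash.
have mp : measurable_fun setT (squash \o u).
  by apply: measurableT_comp => //; exact: measurable_squash.
have mn : measurable_fun setT ((squash \o -%R) \o u).
  by apply: (measurableT_comp measurable_squash).
pose hp y := (\int[T y]_z ((squash \o u) z)%:E)%E.
pose hn y := (\int[T y]_z (((squash \o -%R) \o u) z)%:E)%E.
have mh (f : E -> R) : measurable_fun setT f -> (forall y, 0 <= f y <= 1) ->
    measurable_fun setT (fun y => \int[T y]_z (f z)%:E)%E.
  move=> mf f01; apply: measurable_kernel_integral => //.
    exact/measurable_EFinP.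
  by move=> y; rewrite lee_fin; case/andP : (f01 y).
pose v y := unsquash (fine (hp y)) - unsquash (fine (hn y)).
have mv : measurable_fun setT v.
  apply: measurable_funB; apply: (measurableT_comp measurable_unsquash);
    apply: (measurableT_comp (fine_measurable measurableT)).
    by apply: mh => // y; exact: squash01.
  by apply: mh => // y; exact: squash01.
have maxB (s : R) : Num.max 0 s - Num.max 0 (- s) = s.
  by case: (leP 0 s); case: (leP 0 (- s)); lra.
exists v; split => //.
- move: (stationary_fixed _ _ _ mp sp) (stationary_fixed _ _ _ mn sn).
  rewrite /fixed_fun; apply: filterS2 => x px nx.
  by rewrite /v /hp /hn px nx /= !squashK maxB.
- have := stationary_along mp (fun y => squash01 _) sp.
  have := stationary_along mn (fun y => squash01 _) sn.
  apply: filterS2 => x nx px; apply: (@constant_martingale _ _ (u x)) => //.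
  apply: filterS2 nx px => w nw pw t t0.
  have vE : along Z v t w =
      unsquash (fine (along Z hp t w)) - unsquash (fine (along Z hn t w)).
    rewrite /along; case: (state Z t w) => [//|] /=.
    by rewrite subrr.
  have hpE : along Z hp t w = (squash (u x))%:E by exact: pw.
  have hnE : along Z hn t w = (squash (- u x))%:E by exact: nw.
  apply: (etrans vE).
  apply: (etrans (congr2 (fun p q => unsquash (fine p) - unsquash (fine q)) hpE hnE)).
  exact: (etrans (congr2 (fun p q => p - q) (squashK _) (squashK _)) (maxB _)).
Qed.

(** The martingale property between times 0 and [t] on the whole of [Om], where time 0 contributes
    [v x] since the law is normal. *)
Lemma martingale_mean (v : E -> R) x t : measurable_fun setT v ->
  martingale (law Z x) (filt Z) (along Z v) -> 0 <= t ->
  (\int[position_measure mZ (x, t)]_y (EFin \o v)^\+ y -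
   \int[position_measure mZ (x, t)]_y (EFin \o v)^\- y = (v x)%:E)%E.
Proof.
move=> mv [_ iv cv] t0.
have mvE : measurable_fun setT (EFin \o v) by exact/measurable_EFinP.
rewrite (integral_position mZ x t0 (measurable_funepos mvE))//.
rewrite (integral_position mZ x t0 (measurable_funeneg mvE))//.
have pE w : along Z ((EFin \o v)^\+)%E t w = ((EFin \o along Z v t)^\+)%E w.
  rewrite funeposE /along/=; case: (state Z t w) => [y|] /=; rewrite ?funeposE//.
  by rewrite maxEge lexx.
have nE w : along Z ((EFin \o v)^\-)%E t w = ((EFin \o along Z v t)^\-)%E w.
  rewrite funenegE /along/=; case: (state Z t w) => [y|] /=; rewrite ?funenegE//.
  by rewrite oppr0 maxEge lexx.
under eq_integral do rewrite pE.
under [X in (_ - X)%E]eq_integral do rewrite nE.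
rewrite -integralE.
have F0 : filt Z 0 setT.
  have [[F0 FC _] _] := filt_sigma_algebra mZ (lexx 0).
  by rewrite -(setD0 setT); exact: FC.
rewrite [LHS](cv 0 t setT (lexx 0) t0 F0).
transitivity (\int[law Z x]_w cst (v x)%:E w)%E.
  apply: ae_eq_integral => //.
  - by apply/measurable_EFinP; exact: measurable_along.
  - by apply: filterS (law_normal mZ x) => w s0 _; rewrite /along s0.
rewrite integral_cst// -[RHS]mule1.
by apply: (congr1 (fun I => (v x)%:E * I)%E); exact: probability_setT.
Qed.

(** The constant mean is averaged over an exponential time; finiteness of the integral of [|v|]
    allows the two parts to be averaged separately and then subtracted. *)
Lemma martingale_kernel_integral (v : E -> R) x : measurable_fun setT v ->
  martingale (law Z x) (filt Z) (along Z v) ->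
  (\int[T x]_y (`|v y|)%:E < +oo)%E ->
  (\int[T x]_y (v y)%:E = (v x)%:E)%E.
Proof.
move=> mv martv Tv.
have mvE : measurable_fun setT (EFin \o v) by exact/measurable_EFinP.
have mp := measurable_funepos mvE.
have mn := measurable_funeneg mvE.
have mmax : measurable_fun setT (fun t : R => Num.max 0 t) by exact: measurable_maxr.
have iv : (T x).-integrable setT (EFin \o v) by apply/integrableP; split.
have key (g : E -> \bar R) : measurable_fun setT g -> (forall y, 0 <= g y)%E ->
   (\int[T x]_y g y < +oo)%E ->
   exists A : R -> \bar R, [/\ (exp_law a0).-integrable setT A,
     (forall t, A t = \int[position_measure mZ (x, (Num.max 0 t)%R)]_y g y)%E &
     (\int[T x]_y g y = \int[exp_law a0]_t A t)%E].
  move=> mg g0 Tg.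
  pose A (t : measurableTypeR R) := (\int[position_measure mZ (x, (Num.max 0 (t : R))%R)]_y g y)%E.
  have TA : (\int[T x]_y g y = \int[exp_law a0]_t A t)%E.
    apply: (etrans (integral_resolvent_exp lusO rZ a0 x mg g0)).
    by apply: eq_integral => t _; exact: (integral_position_max rZ x t g).
  exists A; split => //; apply: ge0_integrable.
  - exact: (measurableT_comp (measurable_position_time lusO rZ x mg g0) mmax).
  - by move=> t; apply: integral_ge0 => y _; exact: g0.
  - by rewrite -TA.
have [A [iA AE TA]] := key _ mp (funepos_ge0 _)
  (integral_funepos_lt_pinfty measurableT iv).
have [B [iB BE TB]] := key _ mn (funeneg_ge0 _)
  (integral_funeneg_lt_pinfty measurableT iv).
rewrite integralE [X in (X - _)%E]TA [X in (_ - X)%E]TB -integralB//.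
rewrite -[RHS](integral_exp_law_cst a0); apply: eq_integral => t _.
rewrite AE BE; apply: martingale_mean => //.
by rewrite le_max lexx.
Qed.

(** For almost every [x] the representative may replace [u] both at [x] and under [T x], and
    [kernel_abs_fin] gives the integrability. *)
Lemma ae_martingale_fixed (u : E -> R) : measurable_fun setT u ->
  small_tails m u -> ae_martingale m id Z u -> fixed_fun m T u.
Proof.
move=> mu tu [v [mv vu martv]].
have uv := subinvariant_ae _ _ _ sT mT vu.
have fin := kernel_abs_fin _ _ _ sT mT mu tu.
have muE : measurable_fun setT (EFin \o u) by exact/measurable_EFinP.
have mvE : measurable_fun setT (EFin \o v) by exact/measurable_EFinP.
rewrite /fixed_fun; apply: filterS3 (filterI vu martv) uv fin => x [vux mart] vuT fx.
rewrite -vux -(martingale_kernel_integral mv mart).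
- apply: ae_eq_integral => //.
  by apply: filterS vuT => y <- _.
- apply: le_lt_trans fx; rewrite le_eqVlt; apply/orP; left; apply/eqP.
  apply: ae_eq_integral => //.
  + by apply/measurable_EFinP; exact: measurableT_comp.
  + by apply/measurable_EFinP; exact: measurableT_comp.
  + by apply: filterS vuT => y <- _.
Qed.

End constant_paths.

(** * Generators and the enlarged state space *)

Section acts_by.
Context {R : realType} {d : measure_display} {E : measurableType d}.
Implicit Types (V W : operators R E) (m : {measure set E -> \bar R}).
Implicit Types (T S : E -> {measure set E -> \bar R}).

(** A common interface for resolvents of processes and of kernels: [T] is [a V_a]. *)
Definition acts_by V (a : R) T : Prop := forall f x,
  measurable_fun setT f -> (forall y, 0 <= f y)%E ->
  (V a f x = a^-1%:E * \int[T x]_y f y)%E.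

Lemma weak_duality_in_duality m V W (a : R) T S : 0 < a ->
  submarkov_kernel T -> submarkov_kernel S ->
  acts_by V a T -> acts_by W a S -> weak_duality m V W -> in_duality m T S.
Proof.
move=> a0 sT sS VT WS VW f g mf f0 mg g0.
have ai0 : (0 <= a^-1%:E :> \bar R)%E by rewrite lee_fin invr_ge0 ltW.
have ai : a^-1 != 0 by rewrite invr_eq0 gt_eqF.
have pull (h k : E -> \bar R) (Q : E -> {measure set E -> \bar R}) :
    submarkov_kernel Q -> measurable_fun setT h -> (forall x, 0 <= h x)%E ->
    measurable_fun setT k -> (forall x, 0 <= k x)%E ->
    (\int[m]_x (h x * (a^-1%:E * \int[Q x]_y k y)) =
     a^-1%:E * \int[m]_x (h x * \int[Q x]_y k y))%E.
  move=> sQ mh h0 mk k0; have mQ := measurable_kernel_integral _ _ sQ mk k0.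
  rewrite -ge0_integralZl//.
  - by apply: eq_integral => x _; rewrite muleCA.
  - exact: emeasurable_funM.
  - by move=> x _; rewrite mule_ge0// integral_ge0.
have := VW a f g a0 mf f0 mg g0.
under eq_integral do rewrite VT//.
under [in RHS]eq_integral do rewrite WS//.
rewrite !pull// => /(congr1 (fun z => a%:E * z)%E).
by rewrite !muleA -EFinM mulfV ?gt_eqF// !mul1e.
Qed.

Lemma excessive_subinvariant m V (a : R) T : 0 < a -> acts_by V a T ->
  excessive_measure V m -> subinvariant m T.
Proof.
move=> a0 VT Vm f mf f0; apply: le_trans (Vm a f a0 mf f0).
rewrite le_eqVlt; apply/orP; left; apply/eqP; apply: eq_integral => x _.
by rewrite VT// muleA -EFinM mulfV ?gt_eqF// mul1e.
Qed.

Lemma Lp_op_integral V (a : R) T (f : E -> R) x : 0 < a -> acts_by V a T ->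
  measurable_fun setT f ->
  (Lp_op V a f x = \int[T x]_y (a^-1 * f y)%:E)%E.
Proof.
move=> a0 VT mf.
have ai0 : 0 <= a^-1 by rewrite invr_ge0 ltW.
have mfE : measurable_fun setT (EFin \o f) by exact/measurable_EFinP.
rewrite /Lp_op integralE.
have -> : (fun y => (a^-1 * f y)%:E) = (fun y => a^-1%:E * (EFin \o f) y)%E by [].
rewrite ge0_funeposM// ge0_funenegM// !ge0_integralZl_EFin//.
- by rewrite !VT//; [exact: measurable_funeneg|exact: measurable_funepos].
- exact: measurable_funeneg.
- exact: measurable_funepos.
Qed.

(** From [0 = a u - f] one gets [f = a u], so [u = V_a f] becomes [u = T u]. The rate is the one
    supplied by the generator. *)
Lemma Lp_harmonic_fixed m (p : R) V (u : E -> R) : measurable_fun setT u ->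
  Lp_harmonic m p V u -> exists2 a, 0 < a & forall T, submarkov_kernel T ->
    subinvariant m T -> acts_by V a T -> fixed_fun m T u.
Proof.
move=> mu [v [a [f [a0 fLp uV vE]]] v0]; exists a => // T sT mT VT.
have mf : measurable_fun setT f by have := sub_Lfun_mfun fLp; rewrite inE.
have fu : {ae m, forall x, a^-1 * f x = u x}.
  apply: filterS2 vE v0 => x -> /eqP; rewrite subr_eq0 => /eqP <-.
  by rewrite mulKf ?gt_eqF.
have fuT := subinvariant_ae _ _ _ sT mT fu.
rewrite /fixed_fun; apply: filterS2 uV fuT => x -> fux.
rewrite (Lp_op_integral x a0 VT mf); apply: ae_eq_integral => //.
- exact/measurable_EFinP.
- by apply/measurable_EFinP; exact: measurable_funM.
- by apply: filterS fux => y -> _.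
Qed.

Lemma fixed_Lp_harmonic m (p : R) V (a : R) T (u : E -> R) : 1 <= p ->
  u \in Lfun m p%:E -> 0 < a -> acts_by V a T -> fixed_fun m T u ->
  Lp_harmonic m p V u.
Proof.
move=> p1 uLp a0 VT fixu.
have mu : measurable_fun setT u by have := sub_Lfun_mfun uLp; rewrite inE.
exists (cst 0); last exact: aeW.
exists a, (fun x => a * u x); split => //.
- rewrite (_ : (fun x => _) = a \o* u); last by apply/funext => x; exact: mulrC.
  exact: Lfun_scale.
- move: fixu; rewrite /fixed_fun; apply: filterS => x fx.
  rewrite (Lp_op_integral x a0 VT); last exact: measurable_funM.
  by under eq_integral do rewrite mulKf ?gt_eqF//.
- by apply: aeW => x; rewrite subrr.
Qed.

End acts_by.

Lemma resolvent_acts_by {R : realType} {d d' : measure_display}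
    {E : measurableType d} {Om : measurableType d'} (O : set (set E))
    (Z : process R E Om) (lusO : lusin_topology R O) (rZ : right_process O Z)
    (a : R) (a0 : 0 < a) :
  acts_by (resolvent Z) a (resolvent_kernel lusO rZ a0).
Proof.
move=> f x mf f0; rewrite integral_resolvent// muleA -EFinM mulVf ?gt_eqF//.
by rewrite mul1e.
Qed.

Section kernel_op.
Context {R : realType} {d : measure_display} {E : measurableType d}.
Variables (U : R -> R.-ker E ~> E) (resU : submarkovian_resolvent U).
Variables (a : R) (a0 : 0 < a).

Definition scaled_kernel (x : E) : {measure set E -> \bar R} :=
  mscale (NngNum (ltW a0)) (U a x).

Lemma scaled_kernel_submarkov : submarkov_kernel scaled_kernel.
Proof.
split; last by move=> x; exact: (resolvent_submarkov resU).
move=> A mA; apply: measurable_funeM; exact: measurable_kernel.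
Qed.

Lemma kernel_op_acts_by : acts_by (kernel_op U) a scaled_kernel.
Proof.
move=> f x mf f0; rewrite /scaled_kernel ge0_integral_mscale//= muleA -EFinM.
by rewrite mulVf ?gt_eqF// mul1e.
Qed.

End kernel_op.

(** * Transfer along the inclusion of [E] into the larger space *)

Section measurable_subspace.
Context {R : realType} {d d1 : measure_display}.
Context {E : measurableType d} {Eb : measurableType d1}.
Variables (i : E -> Eb) (subE : measurable_subspace i).

Lemma measurable_inclusion : measurable_fun setT i.
Proof.
by move=> _ B mB; rewrite setTI; have [_ _ H] := subE; apply/H; exists B.
Qed.

Lemma measurable_inclusion_image A : measurable A -> measurable (i @` A).
Proof.
have [_ mi H] := subE; move=> /H[B mB ->].
rewrite (_ : _ @` _ = B `&` range i); first exact: measurableI.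
by apply/seteqP; split => [_ [x Bx <-]|y [By [x _ xy]]]; [split => //; exists x|
  exists x => //; rewrite /= xy].
Qed.

Lemma measurable_extension (u : E -> R) : measurable_fun setT u ->
  exists2 ub : Eb -> R, measurable_fun setT ub & u = ub \o i.
Proof.
move=> mu; have [inji mi _] := subE.
have [ub [ubi ub0]] : exists ub : Eb -> R,
    (forall x, ub (i x) = u x) /\ (forall y, ~ range i y -> ub y = 0).
  have H y : exists r : R, (forall x, i x = y -> r = u x) /\ (~ range i y -> r = 0).
    have [[x _ <-]|ny] := pselect (range i y).
      by exists (u x); split => [x' /inji -> //|[]]; exists x.
    by exists 0; split => // x xy; exfalso; apply: ny; exists x.
  exists (fun y => sval (cid (H y))); split => [x|y ny].
    by have [h _] := svalP (cid (H (i x))); exact: h.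
  by have [_] := svalP (cid (H y)); exact.
exists ub; last by apply/funext => x /=; rewrite ubi.
move=> _ S mS; rewrite setTI.
have mS' : measurable (i @` (u @^-1` S)).
  by apply: measurable_inclusion_image; rewrite -[X in measurable X]setTI; exact: mu.
have [S0|S0] := pselect (S 0).
- rewrite (_ : _ @^-1` _ = i @` (u @^-1` S) `|` ~` range i).
    by apply: measurableU => //; exact: measurableC.
  apply/seteqP; split => [y Sy|y [[x Sx <-]|/ub0 y0]]; last 2 first.
  - by rewrite /= ubi.
  - by rewrite /= y0.
  have [[x _ xy]|ny] := pselect (range i y); last by right.
  by left; exists x => //=; rewrite -ubi xy.
- rewrite (_ : _ @^-1` _ = i @` (u @^-1` S))//.
  apply/seteqP; split => [y Sy|y [x Sx <-]]; last by rewrite /= ubi.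
  have [[x _ xy]|/ub0 y0] := pselect (range i y).
    by exists x => //=; rewrite -ubi xy.
  by exfalso; apply: S0; rewrite -y0.
Qed.

Variables (m : {measure set E -> \bar R}) (mb : {measure set Eb -> \bar R}).
Hypothesis mbE : forall A, measurable A -> mb A = m (i @^-1` A).

(** [mb] is the image of [m], hence does not charge the complement of [range i]. *)
Lemma ae_inclusion (P : Eb -> Prop) :
  {ae mb, forall y, P y} <-> {ae m, forall x, P (i x)}.
Proof.
have [inji mi _] := subE; split => -[N [mN N0 PN]].
- exists (i @^-1` N); split.
  + by rewrite -[X in measurable X]setTI; exact: measurable_inclusion.
  + by rewrite -mbE.
  + by move=> x /= Px; exact: PN.
- have mN' := measurable_inclusion_image mN.
  have mM : measurable (i @` N `|` ~` range i).
    by apply: measurableU => //; exact: measurableC.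
  exists (i @` N `|` ~` range i); split => //.
  + rewrite mbE// -N0; congr (m _); apply/seteqP; split => x.
      by move=> [[x' Nx' /inji <-]//|[]]; exists x.
    by move=> Nx; left; exists x.
  + move=> y /= Py; have [[x _ xy]|ny] := pselect (range i y); last by right.
    by left; exists x => //; apply: PN => /=; rewrite xy.
Qed.

Lemma integral_inclusion (f : Eb -> \bar R) : measurable_fun setT f ->
  (forall y, 0 <= f y)%E -> (\int[mb]_y f y = \int[m]_x f (i x))%E.
Proof.
move=> mf f0.
rewrite (eq_measure_integral (pushforward m i))//.
- exact: measurable_inclusion.
- by move=> mi; rewrite ge0_integral_pushforward.
- by move=> mi A mA _; exact: mbE.
Qed.

Lemma small_tails_inclusion (ub : Eb -> R) : measurable_fun setT ub ->
  small_tails m (ub \o i) -> small_tails mb ub.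
Proof.
move=> mub tu c c0; rewrite integral_inclusion//; first exact: tu.
- apply/measurable_EFinP; apply: measurable_maxr => //.
  by apply: measurable_funB => //; exact: measurableT_comp.
- by move=> y; rewrite lee_fin le_max lexx.
Qed.

Lemma stationary_inclusion (T : E -> {measure set E -> \bar R})
    (Tb : Eb -> {measure set Eb -> \bar R}) (ub : Eb -> R) :
  measurable_fun setT ub ->
  (forall x B, measurable B -> Tb (i x) B = T x (i @^-1` B)) ->
  stationary mb Tb ub <-> stationary m T (ub \o i).
Proof.
move=> mub TbT; rewrite /stationary ae_inclusion.
suff H x : (Tb (i x) [set y | ub y != ub (i x)] = 0%E /\
      (ub (i x) != 0 -> Tb (i x) setT = 1%E)) <->
    (T x [set y | (ub \o i) y != (ub \o i) x] = 0%E /\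
      ((ub \o i) x != 0 -> T x setT = 1%E)).
  by split; apply: filterS => x /H.
rewrite !TbT//; exact: measurable_neq_cst.
Qed.

Lemma ae_martingale_inclusion d2 (Omb : measurableType d2)
    (Z : process R Eb Omb) (ub : Eb -> R) :
  ae_martingale m i Z (ub \o i) <-> ae_martingale mb id Z ub.
Proof.
have aeV (v : Eb -> R) := ae_inclusion (fun y => v y = ub y).
have aeM (v : Eb -> R) :=
  ae_inclusion (fun y => martingale (law Z y) (filt Z) (along Z v)).
by split => -[v [mv vu mart]]; exists v; split => //;
  [exact: (aeV v).2|exact: (aeM v).2|exact: (aeV v).1|exact: (aeM v).1].
Qed.

(** Both sides are exponential mixtures of one-time laws, so the case of a single time in the
    finite-dimensional distributions suffices. *)
Lemma resolvent_kernel_inclusion d2 d3 (Om : measurableType d2)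
    (Omb : measurableType d3) (X : process R E Om) (Xb : process R Eb Omb)
    (O : set (set E)) (Ob : set (set Eb)) (lusO : lusin_topology R O)
    (rX : right_process O X) (lusOb : lusin_topology R Ob)
    (rXb : right_process Ob Xb) (a : R) (a0 : 0 < a) :
  restricts_to i Xb X -> forall x B, measurable B ->
  resolvent_kernel lusOb rXb a0 (i x) B =
  resolvent_kernel lusO rX a0 x (i @^-1` B).
Proof.
move=> [_ fdd] x B mB.
have miB : measurable (i @^-1` B).
  by rewrite -[X in measurable X]setTI; exact: measurable_inclusion.
have ind d4 (F : measurableType d4) (mu : {measure set F -> \bar R}) A :
    measurable A -> mu A = (\int[mu]_y (\1_A y)%:E)%E.
  by move=> mA; rewrite integral_indic// setIT.
rewrite (ind _ _ _ _ mB) (ind _ _ _ _ miB).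
have ge0 d4 (F : measurableType d4) (A : set F) y : (0 <= (\1_A y)%:E :> \bar R)%E.
  by rewrite lee_fin.
have mI d4 (F : measurableType d4) (A : set F) : measurable A ->
    measurable_fun setT (fun y => (\1_A y)%:E : \bar R).
  by move=> mA; apply/measurable_EFinP; exact: measurable_indic.
apply: (etrans (integral_resolvent_exp lusOb rXb a0 (i x) (mI _ _ _ mB) (ge0 _ _ _))).
apply: (etrans _ (esym (integral_resolvent_exp lusO rX a0 x (mI _ _ _ miB) (ge0 _ _ _)))).
apply: eq_integral => t _; rewrite -!ind//.
have := fdd x 1%N (fun=> Num.max 0 (t : R)) (fun=> B) _ (fun=> mB).
rewrite !bigcap_const; try by exists ord0.
by apply => k; rewrite le_max lexx.
Qed.

End measurable_subspace.

Unset Implicit Arguments.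
Set Strict Implicit.
Set Printing Implicit Defensive.

Theorem corollary2 (R : realType) (dE dEb dO dOb dOh : measure_display)
  (* the right process X on the Lusin topological space (E, OE) *)
  (E : measurableType dE) (Om : measurableType dO)
  (OE : set (set E)) (X : process R E Om)
  (lusinE : lusin_topology R OE)
  (rightX : right_process OE X)
  (* the sigma-finite excessive measure m *)
  (m : {sigma_finite_measure set E -> \bar R})
  (excm : excessive_measure (resolvent X) m)
  (* the dual resolvent on E *)
  (Uhat : R -> R.-ker E ~> E)
  (resUhat : submarkovian_resolvent Uhat)
  (dualUhat : weak_duality m (resolvent X) (kernel_op Uhat))
  (* the larger space Eb, the processes Xb and Xhat on it *)
  (Eb : measurableType dEb) (i : E -> Eb)
  (subE : measurable_subspace i)
  (mb : {measure set Eb -> \bar R})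
  (mbE : forall A : set Eb, measurable A -> mb A = m (i @^-1` A))
  (Omb : measurableType dOb) (Omh : measurableType dOh)
  (Ob Oh : set (set Eb))
  (Xb : process R Eb Omb) (Xhat : process R Eb Omh)
  (lusinOb : lusin_topology R Ob) (rightXb : right_process Ob Xb)
  (lusinOh : lusin_topology R Oh) (rightXhat : right_process Oh Xhat)
  (restrXb : restricts_to i Xb X)
  (dualXb : weak_duality mb (resolvent Xb) (resolvent Xhat))
  (extXhat : excessive_extensions i (kernel_op Uhat) (resolvent Xhat))
  (denseE : fine_dense i (resolvent Xhat))
  (p : R) (p1 : 1 <= p) (u : E -> R) (uLp : u \in Lfun m p%:E) :
  [<-> ae_martingale m id X u;
       ae_martingale m i Xhat u;
       Lp_harmonic m p (resolvent X) u;
       Lp_harmonic m p (kernel_op Uhat) u].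
Proof.
have mu : measurable_fun setT u by have := sub_Lfun_mfun uLp; rewrite inE.
have tu := Lfun_small_tails m u p p1 uLp.
have [ub mub uE] := measurable_extension subE mu.
have tub : small_tails mb ub.
  by apply: (small_tails_inclusion subE mbE mub); rewrite -uE.
pose T a (a0 : 0 < a) := resolvent_kernel lusinE rightX a0.
pose Tb a (a0 : 0 < a) := resolvent_kernel lusinOb rightXb a0.
pose Th a (a0 : 0 < a) := resolvent_kernel lusinOh rightXhat a0.
pose S a (a0 : 0 < a) := scaled_kernel Uhat a0.
have sT a (a0 : 0 < a) : submarkov_kernel (T a a0) by exact: resolvent_submarkov_kernel.
have sTb a (a0 : 0 < a) : submarkov_kernel (Tb a a0) by exact: resolvent_submarkov_kernel.
have sTh a (a0 : 0 < a) : submarkov_kernel (Th a a0) by exact: resolvent_submarkov_kernel.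
have sS a (a0 : 0 < a) : submarkov_kernel (S a a0) by exact: scaled_kernel_submarkov.
have TS a (a0 : 0 < a) : in_duality m (T a a0) (S a a0).
  apply: (weak_duality_in_duality a0 (sT a a0) (sS a a0)) dualUhat.
    exact: resolvent_acts_by.
  exact: kernel_op_acts_by.
have TbTh a (a0 : 0 < a) : in_duality mb (Tb a a0) (Th a a0).
  apply: (weak_duality_in_duality a0 (sTb a a0) (sTh a a0)) dualXb;
    exact: resolvent_acts_by.
have mT a (a0 : 0 < a) : subinvariant m (T a a0).
  exact: (excessive_subinvariant a0 (resolvent_acts_by lusinE rightX a0) excm).
have mS a (a0 : 0 < a) : subinvariant m (S a a0).
  exact: (in_duality_subinvariant _ _ _ (sT a a0) (sS a a0) (TS a a0)).
have mTh a (a0 : 0 < a) : subinvariant mb (Th a a0).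
  exact: (in_duality_subinvariant _ _ _ (sTb a a0) (sTh a a0) (TbTh a a0)).
have eS a (a0 : 0 < a) : stationary m (T a a0) u <-> stationary m (S a a0) u.
  split.
    exact: (stationary_dual _ _ _ _ (sT a a0) (sS a a0) (TS a a0) mu tu).
  exact: (stationary_dual _ _ _ _ (sS a a0) (sT a a0)
    (in_duality_sym _ _ _ (TS a a0)) mu tu).
(* [Xhat] is dual to [Xb], not directly to [X]: stationarity is moved from [E] to [Eb] through [Xb]
   and only then across the duality. *)
have eTh a (a0 : 0 < a) : stationary m (T a a0) u <-> stationary mb (Th a a0) ub.
  have eTb : stationary mb (Tb a a0) ub <-> stationary m (T a a0) u.
    rewrite uE; apply: (stationary_inclusion subE mbE mub).
    exact: (resolvent_kernel_inclusion subE).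
  rewrite -eTb; split.
    exact: (stationary_dual _ _ _ _ (sTb a a0) (sTh a a0) (TbTh a a0) mub tub).
  exact: (stationary_dual _ _ _ _ (sTh a a0) (sTb a a0)
    (in_duality_sym _ _ _ (TbTh a a0)) mub tub).
have hatE : ae_martingale m i Xhat u <-> ae_martingale mb id Xhat ub.
  by rewrite uE; exact: (ae_martingale_inclusion subE mbE).
(* The martingale assertions involve no rate, so 1 is chosen when starting from them; harmonicity
   brings its own rate. *)
pose one0 : 0 < 1 :> R := ltr01.
tfae.
- move=> /(ae_martingale_fixed (mT 1 one0) mu tu).
  move=> /(fixed_stationary _ _ _ (sT 1 one0) (mT 1 one0) mu tu) /eTh st.
  by apply/hatE; exact: (stationary_ae_martingale (mTh 1 one0) mub st).
- move=> /hatE /(ae_martingale_fixed (mTh 1 one0) mub tub).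
  move=> /(fixed_stationary _ _ _ (sTh 1 one0) (mTh 1 one0) mub tub) /eTh st.
  exact: (fixed_Lp_harmonic p1 uLp one0 (resolvent_acts_by lusinE rightX one0)
    (stationary_fixed _ _ _ mu st)).
- move=> /(Lp_harmonic_fixed mu)[a a0 fixT].
  have := fixT _ (sT a a0) (mT a a0) (resolvent_acts_by lusinE rightX a0).
  move=> /(fixed_stationary _ _ _ (sT a a0) (mT a a0) mu tu) /eS st.
  exact: (fixed_Lp_harmonic p1 uLp a0 (kernel_op_acts_by Uhat a0)
    (stationary_fixed _ _ _ mu st)).
- move=> /(Lp_harmonic_fixed mu)[a a0 fixS].
  have := fixS _ (sS a a0) (mS a a0) (kernel_op_acts_by Uhat a0).
  move=> /(fixed_stationary _ _ _ (sS a a0) (mS a a0) mu tu) /eS st.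
  exact: (stationary_ae_martingale (mT a a0) mu st).
Qed.
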